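(* Let $m\ge 1$ be an integer. The free $m$-dendriform algebra on one generator $D^{(m)}$ has as series of dimensions the series of Fuss-Catalan numbers, i.e. $\dim D^{(m)}_n = C^{(m)}_n=\frac{1}{mn+1}\binom{mn+n}{n}$ for all $n\ge 1$, and the $m$-dendriform subalgebra $Dp^{(m)}$ of ${}^m\mathbf{FQSym}$ generated by $\mathbf{F}_{1^m}$ is free and isomorphic to $D^{(m)}$.
   Context: All vector spaces are over a field $\mathbb{K}$ of characteristic $0$. **$m$-dendriform algebras.** An $m$-dendriform algebra is a vector space with $m+1$ binary bilinear operations $\prec,\circ_1,\dots,\circ_{m-1},\succ$ such that, with $*=\prec+\circ_1+\dots+\circ_{m-1}+\succ$, for all elements $u,v,w$ and all indices $1\le i,j,k\le m-1$: (1) $(u\prec v)\prec w=u\prec(v*w)$; (2) $(u\circ_i v)\prec w=u\circ_i(v\prec w)$ for all $i$; (3) $(u\succ v)\prec w=u\succ(v\prec w)$; (4) $(u\prec v)\circ_i w=u\circ_i\bigl(v\succ w+\sum_{j\ge i}v\circ_j w\bigr)$ for all $i$; (5) $(u*v)\succ w=u\succ(v\succ w)$; (6) $\bigl(u\succ v+\sum_{j\ge m-i}u\circ_j v\bigr)\circ_i w=u\succ(v\circ_i w)$ for all $i$; (7) $(u\circ_k v)\circ_i w=u\circ_{k+i}(v\circ_i w)$ if $k+i<m$. $D^{(m)}$ is the free $m$-dendriform algebra on one generator, and $D^{(m)}_n$ is its homogeneous component of degree $n$ (spanned by the monomials in which the generator occurs $n$ times). **The algebra ${}^m\mathbf{FQSym}$.**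 An $m$-permutation (of size $n\ge1$) is a word of length $mn$ in which each integer from $1$ to $n$ appears exactly $m$ times. ${}^m\mathbf{FQSym}$ has basis $(\mathbf{F}_\sigma)$ indexed by $m$-permutations, with product $\mathbf{F}_\sigma\mathbf{F}_\tau=\sum_\gamma\mathbf{F}_\gamma$, where $\gamma$ runs over the shifted shuffle of $\sigma$ and $\tau$: all shuffles of the word $\sigma$ with the word $\tau[\max\sigma]$ obtained by adding the maximal letter of $\sigma$ to each letter of $\tau$. For a word $\tau=\tau_1\cdots\tau_p$, a right-to-left minimum is a position $i\in[1,p]$ such that $\tau_j\ge\tau_i$ for all $j>i$; list these positions in decreasing order as $m_1(\tau)=p>m_2(\tau)>\cdots$ (an $m$-permutation has at least $m$ of them). The product is split into $m+1$ operations as follows: each of the following is the sum of the $\mathbf{F}_\gamma$ over those $\gamma$ in the shifted shuffle of $\sigma$ and $\tau$ in which the letter of $\gamma$ coming from the last letter of $\sigma$ is located - for $\mathbf{F}_\sigma\prec\mathbf{F}_\tau$: to the right of the letter coming from position $m_1(\tau)$ of $\tau$; - for $\mathbf{F}_\sigma\circ_i\mathbf{F}_\tau$ ($1\le i\le m-1$): between the letters coming from positions $m_{i+1}(\tau)$ and $m_i(\tau)$ of $\tau$; - for $\mathbf{F}_\sigma\succ\mathbf{F}_\tau$: to the left of the letter coming from position $m_m(\tau)$ of $\tau$. These operations make ${}^m\mathbf{FQSym}$ an $m$-dendriform algebra. $1^m$ denotes the word consisting of $m$ letters $1$. *)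

(* Defs.v *)
From HB Require Import structures.
From mathcomp Require Import all_boot all_order all_algebra.
From mathcomp Require Import finmap boolp.
From mathcomp.multinomials Require Import monalg.

Set Implicit Arguments.
Unset Strict Implicit.
Unset Printing Implicit Defensive.

Import GRing.Theory.
Local Open Scope ring_scope.

(** The m+1 operations prec, circ_1, ..., circ_(m-1), succ are packed in one
    family [op : 'I_m.+1 -> V -> V -> V]: prec is [op ord0], circ_i is [op i]
    for 0 < i < m, and succ is [op ord_max]. *)

Section Dendriform.
Variables (K : fieldType) (m : nat).

Section Laws.
Variables (V : lmodType K) (op : 'I_m.+1 -> V -> V -> V).

Let prec := op ord0.
Let succ := op ord_max.
Let star (u v : V) := \sum_i op i u v.
Let inner (i : 'I_m.+1) : bool := (0 < i < m)%N.

Record is_dendriform : Prop := IsDendriform {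
  dend_linearr : forall i u, linear (op i u);
  dend_linearl : forall i v, linear ((op i)^~ v);
  dend1 : forall u v w, prec (prec u v) w = prec u (star v w);
  dend2 : forall i, inner i -> forall u v w,
    prec (op i u v) w = op i u (prec v w);
  dend3 : forall u v w, prec (succ u v) w = succ u (prec v w);
  dend4 : forall i, inner i -> forall u v w,
    op i (prec u v) w =
    op i u (succ v w + \sum_(j < m.+1 | inner j && (i <= j)%N) op j v w);
  dend5 : forall u v w, succ (star u v) w = succ u (succ v w);
  dend6 : forall i, inner i -> forall u v w,
    op i (succ u v + \sum_(j < m.+1 | inner j && (m - i <= j)%N) op j u v) w =
    succ u (op i v w);
  dend7 : forall i k, inner i -> inner k -> (k + i < m)%N -> forall u v w,
    op i (op k u v) w = op (inord (k + i)) u (op i v w)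
}.

End Laws.

Definition is_dend_morphism (V W : lmodType K)
    (opV : 'I_m.+1 -> V -> V -> V) (opW : 'I_m.+1 -> W -> W -> W)
    (f : V -> W) : Prop :=
  forall i u v, f (opV i u v) = opW i (f u) (f v).

Definition dend_isomorphic (V W : lmodType K)
    (opV : 'I_m.+1 -> V -> V -> V) (opW : 'I_m.+1 -> W -> W -> W) : Prop :=
  exists2 f : {linear V -> W}, bijective f & is_dend_morphism opV opW f.

(** (V, op) is the free m-dendriform algebra on the single generator x. *)
Definition is_free_dendriform (V : lmodType K)
    (op : 'I_m.+1 -> V -> V -> V) (x : V) : Prop :=
  is_dendriform op /\
  forall (A : lmodType K) (opA : 'I_m.+1 -> A -> A -> A),
    is_dendriform opA -> forall a : A,
    exists f : {linear V -> A},
      [/\ is_dend_morphism op opA f, f x = a &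
          forall g : {linear V -> A},
            is_dend_morphism op opA g -> g x = a -> g =1 f].

Inductive monomial : Type :=
  | MGen
  | MOp of 'I_m.+1 & monomial & monomial.

Fixpoint mon_degree (t : monomial) : nat :=
  match t with
  | MGen => 1
  | MOp _ t1 t2 => mon_degree t1 + mon_degree t2
  end.

Section Subspaces.
Variables (V : lmodType K) (op : 'I_m.+1 -> V -> V -> V) (x : V).

Fixpoint mon_eval (t : monomial) : V :=
  match t with
  | MGen => x
  | MOp i t1 t2 => op i (mon_eval t1) (mon_eval t2)
  end.

Definition in_span (S : V -> Prop) (v : V) : Prop :=
  exists (k : nat) (c : 'I_k -> K) (w : 'I_k -> V),
    (forall i, S (w i)) /\ v = \sum_i c i *: w i.

Definition homogeneous (n : nat) : V -> Prop :=
  in_span (fun v => exists2 t, mon_degree t = n & v = mon_eval t).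

(** The subspace [W] has a basis with exactly [d] elements; [V] itself may be
    infinite dimensional, so that [vectType] and [\dim] do not apply. *)
Definition has_dim (W : V -> Prop) (d : nat) : Prop :=
  exists b : 'I_d -> V,
    [/\ forall i, W (b i),
        forall c : 'I_d -> K, \sum_i c i *: b i = 0 -> forall i, c i = 0 &
        forall v, W v -> exists c : 'I_d -> K, v = \sum_i c i *: b i].

Inductive generated : V -> Prop :=
  | generated_gen : generated x
  | generated_op i u v : generated u -> generated v -> generated (op i u v)
  | generated_0 : generated 0
  | generated_lin a u v :
      generated u -> generated v -> generated (a *: u + v).

Definition subalg_pred : {pred V} := [pred v | `[< generated v >]].

Lemma subalg_predP v : reflect (generated v) (v \in subalg_pred).
Proof. exact: asboolP. Qed.

Lemma subalg_submod_closed : submod_closed subalg_pred.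
Proof.
split=> [|a u v /subalg_predP gu /subalg_predP gv]; apply/subalg_predP.
  exact: generated_0.
exact: generated_lin.
Qed.

HB.instance Definition _ :=
  GRing.isSubmodClosed.Build K V subalg_pred subalg_submod_closed.

(** The subalgebra generated by x, as a vector space of its own. *)
Record subalg := Subalg { subalg_val : V; subalg_valP : subalg_val \in subalg_pred }.

HB.instance Definition _ := [isSub for subalg_val].
HB.instance Definition _ := [Choice of subalg by <:].
HB.instance Definition _ := [SubChoice_isSubLmodule of subalg by <:].

Lemma subalg_op_subproof i (u v : subalg) :
  op i (subalg_val u) (subalg_val v) \in subalg_pred.
Proof.
by apply/subalg_predP/generated_op; apply/subalg_predP; apply: subalg_valP.
Qed.

Definition subalg_op (i : 'I_m.+1) (u v : subalg) : subalg :=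
  Subalg (subalg_op_subproof i u v).

Lemma subalg_gen_subproof : x \in subalg_pred.
Proof. exact/subalg_predP/generated_gen. Qed.

Definition subalg_gen : subalg := Subalg subalg_gen_subproof.

End Subspaces.
End Dendriform.

Section Words.
Local Open Scope nat_scope.

Definition is_mperm (m : nat) (w : seq nat) : bool :=
  let n := size w %/ m in
  [&& 0 < n, size w == m * n & all (fun k => count_mem k w == m) (iota 1 n)].

(** Shuffle of s and t along b: b lists, for each position of the shuffle,
    whether its letter comes from s (true) or from t (false). *)
Fixpoint shuffle (b : bitseq) (s t : seq nat) : seq nat :=
  match b, s, t with
  | true :: b', x :: s', _ => x :: shuffle b' s' t
  | false :: b', _, y :: t' => y :: shuffle b' s t'
  | _, _, _ => [::]
  end.

Definition shift (s t : seq nat) : seq nat :=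
  [seq (\max_(x <- s) x) + y | y <- t].

(** Position, in a shuffle along b, of the letter coming from position k of s
    (c = true) or of t (c = false). All positions are counted from 0. *)
Definition letter_pos (c : bool) (b : bitseq) (k : nat) : nat :=
  nth 0 [seq p <- iota 0 (size b) | nth false b p == c] k.

Definition is_rlmin (t : seq nat) (i : nat) : bool :=
  all (fun j => (i < j) ==> (nth 0 t i <= nth 0 t j)) (iota 0 (size t)).

Definition rlmins (t : seq nat) : seq nat :=
  rev [seq i <- iota 0 (size t) | is_rlmin t i].

(** The position m_i(t) of the i-th right-to-left minimum, for i >= 1. *)
Definition rlmin (t : seq nat) (i : nat) : nat := nth 0 (rlmins t) i.-1.

(** The shuffles occurring in the i-th operation, 0 <= i <= m: the last letter
    of s is to the right of the letter at m_(i+1)(t) (no condition if i = m)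
    and to the left of the letter at m_i(t) (no condition if i = 0). *)
Definition split_cond (m i : nat) (s t : seq nat) (b : bitseq) : bool :=
  let l := letter_pos true b (size s).-1 in
  ((i < m) ==> (letter_pos false b (rlmin t i.+1) < l)) &&
  ((0 < i) ==> (l < letter_pos false b (rlmin t i))).

Definition is_shuffle_mask (s t : seq nat) (b : bitseq) : bool :=
  (size b == size s + size t) && (count id b == size s).

Lemma perm_shuffle (b : bitseq) (s t : seq nat) :
  is_shuffle_mask s t b -> perm_eq (shuffle b s t) (s ++ t).
Proof.
rewrite /is_shuffle_mask.
elim: b s t => [|[] b IH] s t /=.
- by case: s t => [|x s] [|y t].
- case: s => [|x s]; first by case/andP.
  rewrite addSn !eqSS => H.
  by rewrite /= perm_cons; apply: IH.
case: t => [|y t].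
  rewrite addn0 add0n => /andP[/eqP sb /eqP cb].
  by have := count_size id b; rewrite cb -sb ltnn.
rewrite addnS eqSS => H.
suff: perm_eq (y :: shuffle b s t) (s ++ y :: t) by case: s {H}.
by rewrite perm_sym -cat1s perm_catCA /= perm_cons perm_sym; apply: IH.
Qed.

Lemma is_mpermP (m : nat) (w : seq nat) : 0 < m ->
  reflect (exists2 n, 0 < n & perm_eq w (flatten [seq nseq m k | k <- iota 1 n]))
          (is_mperm m w).
Proof.
move=> m0.
have cE k n : count_mem k (flatten [seq nseq m j | j <- iota 1 n]) =
              (k \in iota 1 n) * m.
  rewrite count_flatten -map_comp.
  elim: n 1 => [|n IH] a //=; rewrite IH count_nseq in_cons /= [a == k]eq_sym.
  by case: eqP => [->|_] //=; rewrite mem_iota ltnn addn0.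
have sE n : size (flatten [seq nseq m j | j <- iota 1 n]) = m * n.
  rewrite size_flatten /shape -map_comp sumnE big_map /=.
  rewrite (eq_bigr (fun=> m)) => [|j _]; last by rewrite size_nseq.
  by rewrite big_const_seq count_predT size_iota iter_addn_0.
apply: (iffP and3P) => [[n0 /eqP sw /allP cw]|[n n0 pw]].
  set n := size w %/ m in n0 sw cw; exists n => //.
  have wP : all (mem (iota 1 n)) w.
    rewrite all_count sw -sE.
    rewrite (_ : count _ w =
                 count (mem (iota 1 n)) (flatten [seq nseq m j | j <- iota 1 n])).
      rewrite -all_count; apply/allP => k /flattenP[_ /mapP[j jn ->]].
      by rewrite mem_nseq => /andP[_ /eqP->].
    have cM (s r : seq nat) : uniq r ->
        count (mem r) s = \sum_(k <- r) count_mem k s.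
      elim: r => [_|a r IH /= /andP[ar ur]].
        by rewrite big_nil; elim: s => //= a s ->.
      rewrite big_cons -IH // -count_predUI -[LHS]addn0; congr (_ + _).
      apply/esym/eqP; rewrite eqn0Ngt -has_count; apply/hasP => -[k _ /=].
      by case/andP=> /eqP -> ; rewrite (negbTE ar).
    rewrite !cM ?iota_uniq //; apply: eq_big_seq => k kn.
    by rewrite cE kn mul1n (eqP (cw _ kn)).
  apply/allP => k _ /=; rewrite cE; case: (boolP (k \in iota 1 n)) => kn /=.
    by rewrite mul1n (cw _ kn).
  rewrite mul0n; apply/eqP/count_memPn; apply: contra kn; exact: (allP wP).
have sw : size w = m * n by rewrite (perm_size pw) sE.
rewrite sw mulKn // eqxx; split=> //; apply/allP => k kn.
by rewrite (permP pw) cE kn mul1n.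
Qed.

Lemma ones_mperm (m : nat) : 0 < m -> is_mperm m (nseq m 1%N).
Proof. by move=> m0; apply/(is_mpermP _ m0); exists 1; rewrite //= cats0. Qed.

Lemma shuffle_mperm (m : nat) (b : bitseq) (s t : seq nat) :
  0 < m -> is_mperm m s -> is_mperm m t -> is_shuffle_mask s t b ->
  is_mperm m (shuffle b s (shift s t)).
Proof.
move=> m0 /(is_mpermP _ m0)[p p0 ps] /(is_mpermP _ m0)[q q0 qt] bP.
apply/(is_mpermP _ m0); exists (p + q); first by rewrite addn_gt0 p0.
have maxE : \max_(x <- s) x = p.
  rewrite (perm_big _ ps) /= big_flatten big_map.
  rewrite (eq_bigr id) => [|k _].
    rewrite -{2}(prednK p0); elim: p p0 {ps} => // -[|p] IH _.
      by rewrite big_cons big_nil.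
    have -> : iota 1 p.+2 = iota 1 p.+1 ++ [:: p.+2].
      by rewrite -{1}(addn1 p.+1) iotaD add1n.
    by rewrite big_cat IH //= big_seq1; apply/maxn_idPr.
  case: m m0 {ps qt bP} => // m _.
  elim: m => [|m IH]; first by rewrite big_seq1.
  by rewrite [nseq _ _]/= big_cons IH; apply: maxnn.
apply: (@perm_trans _ (s ++ shift s t)); first apply: perm_shuffle.
  by rewrite /is_shuffle_mask /shift size_map.
rewrite iotaD map_cat flatten_cat; apply: perm_cat => //.
rewrite /shift maxE; apply: (perm_trans (perm_map _ qt)).
rewrite map_flatten -map_comp [(1 + p)%N]addnC iotaDl -map_comp.
have E : (map (addn p)) \o (nseq m) =1 (nseq m) \o (addn p).
  by move=> k /=; rewrite map_nseq.
by rewrite (eq_map E).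
Qed.

End Words.

Record mperm (m : nat) := MPerm { mperm_val : seq nat; _ : is_mperm m mperm_val }.
HB.instance Definition _ m := [isSub for @mperm_val m].
HB.instance Definition _ m := [Countable of mperm m by <:].

Section MFQSym.
Variables (K : fieldType) (m : nat).

Definition mFQSym : Type := {malg K[mperm m]}.
HB.instance Definition _ := GRing.Lmodule.on mFQSym.

(** F_w for a word w; the default value 0 is never used below, thanks to
    [ones_mperm] and [shuffle_mperm]. *)
Definition mF (w : seq nat) : mFQSym :=
  if insub w is Some p then << (p : mperm m) >> else 0.

Definition mF_op (i : 'I_m.+1) (s t : mperm m) : mFQSym :=
  let: (s, t) := (mperm_val s, mperm_val t) in
  \sum_(b : (size s + size t).-tuple bool |
        is_shuffle_mask s t b && split_cond m i s t b)
    mF (shuffle b s (shift s t)).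

Definition mFQSym_op (i : 'I_m.+1) (u v : mFQSym) : mFQSym :=
  \sum_(s <- msupp u) \sum_(t <- msupp v) (u@_s * v@_t) *: mF_op i s t.

Definition Dp : lmodType K := subalg mFQSym_op (mF (nseq m 1%N)).
Definition Dp_op : 'I_m.+1 -> Dp -> Dp -> Dp :=
  @subalg_op K m mFQSym mFQSym_op (mF (nseq m 1%N)).
Definition Dp_gen : Dp := subalg_gen mFQSym_op (mF (nseq m 1%N)).

End MFQSym.

Definition fuss_catalan (m n : nat) : nat :=
  ('C(m * n + n, n) %/ (m * n).+1)%N.

Lemma dvdn_fuss_catalan (m n : nat) :
  ((m * n).+1 %| 'C(m * n + n, n))%N.
Proof.
case: n => [|n]; first by rewrite muln0 dvd1n.
rewrite -(@Gauss_dvdr _ n.+1); last first.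
  by rewrite coprime_sym /coprime -[(m * n.+1).+1]addn1 gcdnMDl gcdn1.
have -> : 'C(m * n.+1 + n.+1, n.+1) = 'C(m * n.+1 + n.+1, m * n.+1).
  by rewrite -bin_sub ?leq_addl // addnK.
apply/dvdnP; exists ('C(m * n.+1 + n.+1, (m * n.+1).+1)).
by rewrite [RHS]mulnC mul_bin_left addKn.
Qed.

(** The division in [fuss_catalan] is exact. *)
Lemma fuss_catalanE (m n : nat) :
  (fuss_catalan m n)%:R = ((m * n).+1)%:R^-1 * 'C(m * n + n, n)%:R :> rat.
Proof.
rewrite -(divnK (dvdn_fuss_catalan m n)) natrM mulrCA mulVf ?mulr1 //.
by rewrite Num.Theory.pnatr_eq0.
Qed.

(* Main.v *)
Require Import Defs.
From HB Require Import structures.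
From mathcomp Require Import all_boot all_order all_algebra.
From mathcomp Require Import finmap boolp zify.
From mathcomp.multinomials Require Import monalg.

(** Call a monomial normal when the labels along each of its right spines are
    strictly increasing: these are the (m+1)-ary trees.  The dendriform relations,
    read as rewriting rules for u op_a (v op_b w) with a >= b, show that normal
    monomials span every m-dendriform algebra generated by one element.

    In mFQSym, let R(p, w) be the number of right-to-left minima of w of value
    larger than p.  The coefficient of F_w in u op_i v is the sum of
    u(w restricted to [1, p]) v(w restricted to ]p, n]) over the p such that
    min(m, R(p, w)) = i.  For p < q one has R(p, w) = R(q, w) + R(p, w|[1, q]) and
    R(q, w) <= R(q, w|]p, n]), with equality if R(p, w|[1, q]) > 0; all the
    dendriform relations are instances of this.

    The lexicographically largest word of the normal monomial built from
    t_0, ..., t_m is t_m k t_(m-1) k ... k t_0, with k the maximal letter, from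
    which the t_i are recovered; hence normal monomials are linearly independent
    in mFQSym, and both claims follow.  They are counted by the recurrence
    B(n+1, r+1) = B(n+1, r) + B(n, r+m+1) for forests of r trees with n nodes. *)

Set Implicit Arguments.
Unset Strict Implicit.
Unset Printing Implicit Defensive.

Import GRing.Theory.

(** * Right-to-left minima and restriction of words to value intervals *)

(* R(p, w) of the header *)
Fixpoint nmin (p : nat) (w : seq nat) : nat :=
  if w is x :: w' then ((p < x) && all (leq x) w') + nmin p w' else 0.

(** For an m-permutation [w] of size n and 1 <= p < n, these are the only m-permutations of sizes p
    and n - p whose shifted shuffle contains [w]. *)
Definition lo (p : nat) (w : seq nat) := [seq x <- w | x <= p].
Definition hi (p : nat) (w : seq nat) := [seq x - p | x <- w & p < x].

Lemma nmin_addn k p w : nmin (k + p) (map (addn k) w) = nmin p w.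
Proof.
elim: w => //= x w ->; rewrite ltn_add2l all_map; congr (_ + _); congr (nat_of_bool (_ && _)).
by apply: eq_all => y /=; rewrite leq_add2l.
Qed.

(** Letters above [q] never prevent a letter at most [q] from being a minimum, so the minima with
    value in ]p, q] can be counted in [lo q w]. *)
Lemma nmin_lo p q w : p <= q -> nmin p w = nmin q w + nmin p (lo q w).
Proof.
move=> pq; elim: w => //= x w ->; rewrite /lo /=; case: (leqP x q) => xq /=.
  suff -> : all (leq x) w = all (leq x) (filter (leq^~ q) w) by rewrite addnCA.
  by rewrite all_filter; apply: eq_in_all => y _ /=; case: leqP => //=; lia.
by rewrite (leq_ltn_trans pq xq) addnA.
Qed.

Lemma hiK p w : map (addn p) (hi p w) = [seq x <- w | p < x].
Proof.
rewrite /hi -map_comp -[RHS]map_id; apply/eq_in_map => x /=.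
by rewrite mem_filter => /andP[px _]; rewrite subnKC // ltnW.
Qed.

Lemma nmin_hi_filter p q w :
  p <= q -> nmin (q - p) (hi p w) = nmin q [seq x <- w | p < x].
Proof. by move=> pq; rewrite -hiK -{2}(subnKC pq) nmin_addn. Qed.

(** Deleting the letters at most [p] can only create new right-to-left minima. *)
Lemma nmin_hi_geq p q w : p <= q -> nmin q w <= nmin (q - p) (hi p w).
Proof.
move=> pq; rewrite nmin_hi_filter //; elim: w => //= x w IH.
case: (leqP x p) => xp /=; first by rewrite ltnNge (leq_trans xp pq).
apply: leq_add => //; case: (q < x) => //=; case: (boolP (all _ w)) => // /allP H.
rewrite lt0b; apply/allP => y; rewrite mem_filter => /andP[_]; exact: H.
Qed.

(** A minimum of [lo q w] with value in ]p, q] has no letter at most [p] after it, so the deletion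
    changes nothing there; and no letter above [q] before it is a minimum, with or without the
    deletion. *)
Lemma nmin_hi_eq p q w :
  p <= q -> 0 < nmin p (lo q w) -> nmin (q - p) (hi p w) = nmin q w.
Proof.
move=> pq; rewrite nmin_hi_filter //; elim: w => //= x w IH; rewrite /lo /=.
case: (leqP x q) => xq /=.
  rewrite addn_gt0 lt0b => /orP[/andP[px xm]|/IH IHw]; last first.
    by case: ifP => //= _; rewrite IHw ltnNge xq.
  rewrite px /= ltnNge xq /= add0n; congr (nmin q _).
  have aw : all (ltn p) w.
    apply/allP => y yw /=; case: (leqP y q) => [yq|]; last by lia.
    by move/allP: xm => /(_ y); rewrite mem_filter yq yw => /(_ isT); lia.
  by apply/all_filterP.
move=> a0; rewrite (leq_ltn_trans pq xq) /= IH //; congr (_ + _).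
(* Such a [y] survives the deletion of the letters at most [p], so the letter [x > q] in front of it
   is a minimum neither before nor after. *)
have [y] : exists2 y, y \in w & p < y <= q.
  elim: {IH} w a0 => //= y w IHw; rewrite /lo /=; case: (leqP y q) => yq /=.
    rewrite addn_gt0 lt0b => /orP[/andP[py _]|/IHw [z zw zpq]].
      by exists y; rewrite ?mem_head ?py.
    by exists z; rewrite // in_cons zw orbT.
  by case/IHw => z zw zpq; exists z; rewrite // in_cons zw orbT.
move=> yw /andP[py yq].
have -> : all (leq x) w = false.
  by apply/negP => /allP/(_ y yw); lia.
rewrite xq /=; apply/eqP; rewrite eqb0.
by apply/negP => /allP/(_ y); rewrite mem_filter py yw => /(_ isT); lia.
Qed.

Lemma lo_lo p q w : p <= q -> lo p (lo q w) = lo p w.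
Proof.
move=> pq; rewrite /lo -filter_predI; apply: eq_filter => x /=.
by case: leqP => //=; lia.
Qed.

Lemma lo_hi p q w : p <= q -> lo (q - p) (hi p w) = hi p (lo q w).
Proof.
move=> pq; rewrite /lo /hi filter_map -!filter_predI; congr map.
by apply: eq_filter => x /=; lia.
Qed.

Lemma hi_hi p q w : p <= q -> hi (q - p) (hi p w) = hi q w.
Proof.
move=> pq; rewrite /hi filter_map -!map_comp -!filter_predI.
rewrite [filter (predI _ _) w](@eq_filter _ _ (ltn q)) => [|x /=]; last by lia.
by apply/eq_in_map => x /=; rewrite mem_filter /=; lia.
Qed.

Definition lomask (p : nat) (w : seq nat) : bitseq := [seq x <= p | x <- w].

Lemma shuffle_lomask p w :
  shuffle (lomask p w) (lo p w) [seq x <- w | p < x] = w.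
Proof.
elim: w => //= x w IH; rewrite /lo /=; case: leqP => xp /=; first by rewrite IH.
by move: IH; rewrite /lo; case: [seq x <- w | x <= p] => [|a l] ->.
Qed.

Lemma is_shuffle_lomask p w :
  is_shuffle_mask (lo p w) [seq x <- w | p < x] (lomask p w).
Proof.
rewrite /is_shuffle_mask /lomask size_map !size_filter count_map; apply/andP; split.
  by rewrite -(count_predC (leq^~ p)); apply/eqP; congr (_ + _); apply: eq_count => x /=; lia.
by apply/eqP; apply: eq_count.
Qed.

(** The threshold [p] tells which factor a letter comes from, so a shuffle determines its mask;
    hence no word occurs twice in a product of two basis elements. *)
Lemma shuffle_filter p s t b : is_shuffle_mask s t b ->
  all (geq p) s -> all (ltn p) t ->
  [/\ lo p (shuffle b s t) = s, [seq x <- shuffle b s t | p < x] = t &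
      lomask p (shuffle b s t) = b].
Proof.
rewrite /is_shuffle_mask /lo.
elim: b s t => [|[] b IH] s t.
- by case: s t => [|x s] [|y t].
- case: s => [|x s] /=; first by case/andP.
  rewrite addSn !eqSS => H /andP[xp sp] tp.
  by have [-> -> ->] := IH _ _ H sp tp; rewrite xp ltnNge xp.
case: t => [|y t].
  rewrite /= addn0 add0n => /andP[/eqP sb /eqP cb].
  by have := count_size id b; rewrite cb -sb ltnn.
have -> : shuffle (false :: b) s (y :: t) = y :: shuffle b s t by case: (s).
rewrite /= addnS eqSS => H sp /andP[py tp].
have [E1 E2 E3] := IH _ _ H sp tp.
by rewrite E1 E2 E3 py leqNgt py.
Qed.

(** * Shuffle masks and positions of letters *)

Definition occ (c : bool) (b : bitseq) : seq nat :=
  [seq p <- iota 0 (size b) | nth false b p == c].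

Lemma occ_cat c b1 b2 : occ c (b1 ++ b2) = occ c b1 ++ map (addn (size b1)) (occ c b2).
Proof.
rewrite /occ size_cat iotaD filter_cat add0n; congr (_ ++ _).
  by apply: eq_in_filter => p; rewrite mem_iota /= nth_cat => ->.
rewrite -[in iota _ _](addn0 (size b1)) iotaDl filter_map; congr map.
by apply: eq_filter => p /=; rewrite nth_cat ltnNge leq_addr /= addKn.
Qed.

Lemma size_occ c b : size (occ c b) = count (pred1 c) b.
Proof.
elim: b => //= x b IH; rewrite -cat1s occ_cat size_cat size_map IH.
by congr (_ + _); rewrite /occ /=; case: eqP.
Qed.

Lemma mem_occ c b j : (j \in occ c b) = (nth false b j == c) && (j < size b).
Proof. by rewrite mem_filter mem_iota. Qed.

(** Isolating the last [true] of a mask, which is the place of the last letter of the left factor,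
    gives the form [b ++ true :: nseq f false]. *)
Lemma letter_pos_last b f :
  letter_pos true (b ++ true :: nseq f false) (count id (b ++ true :: nseq f false)).-1
  = size b.
Proof.
rewrite /letter_pos -/(occ true _) occ_cat count_cat /= count_nseq mul0n addn0 addn1 /=.
rewrite nth_cat size_occ (_ : count (pred1 true) b = count id b); last first.
  by apply: eq_count => -[].
by rewrite ltnn subnn.
Qed.

Lemma letter_pos_false b f k :
  let b' := b ++ true :: nseq f false in
  k < count (pred1 false) b + f ->
  (size b < letter_pos false b' k) = (count (pred1 false) b <= k) /\
  (letter_pos false b' k < size b) = (k < count (pred1 false) b).
Proof.
move=> b' kf; rewrite /letter_pos -/(occ false _) occ_cat nth_cat size_occ.
case: (ltnP k) => kb.
  have : nth 0 (occ false b) k \in occ false b by rewrite mem_nth ?size_occ.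
  by rewrite mem_occ => /andP[_ h]; split; lia.
have kf' : k - count (pred1 false) b < size (occ false (true :: nseq f false)).
  by rewrite size_occ /= count_nseq /= mul1n add0n ltn_subLR.
rewrite (nth_map 0) //; have := mem_nth 0 kf'; rewrite mem_occ.
by case: (nth 0 _ _) => [|j] //= _; split; lia.
Qed.

Lemma is_rlmin_drop t i : i < size t ->
  is_rlmin t i = all (leq (nth 0 t i)) (drop i.+1 t).
Proof.
move=> it; rewrite /is_rlmin; apply/allP/(all_nthP 0) => H j.
  rewrite size_drop => jt; rewrite nth_drop.
  have /H : i.+1 + j \in iota 0 (size t) by rewrite mem_iota; lia.
  by rewrite addSn ltnS leq_addr.
rewrite mem_iota => /andP[_ jt]; apply/implyP => ij.
by have := H (j - i.+1); rewrite nth_drop subnKC // size_drop; apply; lia.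
Qed.

(** Bridge between the minima listed by position, from which the operations are defined, and the
    recursive count [nmin]. Letters are positive so that the threshold 0 discards none. *)
Lemma count_rlmin t T : all (ltn 0) t ->
  count (is_rlmin t) (iota T (size t - T)) = nmin 0 (drop T t).
Proof.
elim: t T => [|x t IH] [|T] //= /andP[x0 t0].
  have := IH 0 t0; rewrite drop0 => <-; rewrite subn0 ?x0 /=; congr (nat_of_bool _ + _).
    by rewrite -[LHS]/(is_rlmin (x :: t) 0) is_rlmin_drop //= drop0.
  rewrite -[1]addn0 iotaDl count_map; apply: eq_in_count => i.
  by rewrite mem_iota => /= it; rewrite /= !is_rlmin_drop.
rewrite subSS -IH // -[T.+1]add1n iotaDl count_map; apply: eq_in_count => i.
rewrite mem_iota => it; have it' : i < size t by lia.
by rewrite /= add1n !is_rlmin_drop.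
Qed.

(** In a decreasing list the entries at least [T] form a prefix. *)
Lemma nth_geq_count s T j : sorted gtn s -> j < size s ->
  (T <= nth 0 s j) = (j < count (leq T) s).
Proof.
elim: s j => // x s IH [|j] xs /=; last first.
  rewrite ltnS => js; rewrite (IH _ (path_sorted xs) js).
  have : all (gtn x) s by apply: order_path_min xs => a b c; lia.
  case: (leqP T x) => [|xT] // al; rewrite add0n.
  have -> : count (leq T) s = 0; last by rewrite !ltn0.
  apply/eqP; rewrite -leqn0 leqNgt -has_count; apply/hasPn => y /(allP al) /=; lia.
move=> _; have : all (gtn x) s by apply: order_path_min xs => a b c; lia.
case: (leqP T x) => [|xT] // al; rewrite add0n; apply/esym.
apply/negbTE; rewrite -has_count; apply/hasPn => y /(allP al) /=; lia.
Qed.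

Lemma rlmins_sorted t : sorted gtn (rlmins t).
Proof. by rewrite /rlmins rev_sorted; apply/sorted_filter/iota_ltn_sorted/ltn_trans. Qed.

Lemma size_rlmins t : all (ltn 0) t -> size (rlmins t) = nmin 0 t.
Proof. by move=> t0; rewrite size_rev size_filter -[size t]subn0 count_rlmin ?drop0. Qed.

Lemma count_rlmins t T : all (ltn 0) t ->
  count (leq T) (rlmins t) = nmin 0 (drop T t).
Proof.
move=> t0; rewrite count_rev -count_rlmin // count_filter.
case: (leqP T (size t)) => Tt; last first.
  rewrite (_ : size t - T = 0) /=; last by lia.
  apply/eqP; rewrite -leqn0 leqNgt -has_count; apply/hasPn => y.
  by rewrite mem_iota /=; lia.
rewrite -{1}(subnKC Tt) iotaD count_cat add0n [X in X + _](_ : _ = 0) ?add0n.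
  by apply: eq_in_count => y; rewrite mem_iota /= => /andP[-> _].
apply/eqP; rewrite -leqn0 leqNgt -has_count; apply/hasPn => y.
by rewrite mem_iota /=; lia.
Qed.

(** Let [N] be the number of right-to-left minima of [t] lying to the right of the last letter of
    [s]. As [rlmins] is decreasing, the two conditions read [N <= i] if [i < m], and [i <= N]. The
    bound on [nmin 0 t] keeps [rlmin] away from its default value. *)
Lemma split_condE m i (s t : seq nat) b f :
  0 < m -> i <= m -> all (ltn 0) t -> m <= nmin 0 t ->
  let b' := b ++ true :: nseq f false in
  is_shuffle_mask s t b' ->
  split_cond m i s t b' = (minn m (nmin 0 (drop (count (pred1 false) b) t)) == i).
Proof.
move=> m0 im t0 mt b' /andP[/eqP sb /eqP cb].
set T := count _ b; set N := nmin 0 _.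
have st : size t = T + f.
  have := count_predC id b'; rewrite cb sb => /addnI <-.
  rewrite count_cat /= count_nseq mul1n add0n; congr (_ + _).
  by apply: eq_count => -[].
have H j : j < m ->
    (size b < letter_pos false b' (rlmin t j.+1)) = (j < N) /\
    (letter_pos false b' (rlmin t j.+1) < size b) = (N <= j).
  move=> jm; have js : j < size (rlmins t) by rewrite size_rlmins //; lia.
  have rt : rlmin t j.+1 < T + f.
    rewrite -st /rlmin /=; have := mem_nth 0 js.
    by rewrite mem_rev mem_filter mem_iota => /and3P[].
  have [-> ->] := letter_pos_false rt.
  have E : (T <= rlmin t j.+1) = (j < N).
    by rewrite /N -count_rlmins // -nth_geq_count ?rlmins_sorted.
  by split; [exact: E|rewrite ltnNge E -leqNgt].
rewrite /split_cond -cb letter_pos_last.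
have -> : (0 < i) ==> (size b < letter_pos false b' (rlmin t i)) = (i <= N).
  by case: i im => // i im; have [-> _] := H _ im.
have -> : (i < m) ==> (letter_pos false b' (rlmin t i.+1) < size b)
          = ((i < m) ==> (N <= i)).
  by case: (ltnP i m) => // im'; have [_ ->] := H _ im'.
by case: (ltnP i m) => /=; lia.
Qed.

Lemma nmin_suffix p w1 w2 : has (leq^~ p) w2 -> nmin p (w1 ++ w2) = nmin p w2.
Proof.
move=> h; elim: w1 => //= x w1 ->; rewrite all_cat.
have -> // : (p < x) && (all (leq x) w1 && all (leq x) w2) = false.
apply/negP => /and3P[px _ /allP xw2]; case/hasP: h => y /xw2 /=; lia.
Qed.

Lemma lomask_split p w : has (leq^~ p) w ->
  exists w1 x w2, [/\ w = w1 ++ x :: w2, x <= p & all (ltn p) w2].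
Proof.
elim: w => //= y w IH; case: (boolP (has _ w)) => [/IH[w1 [x [w2 [-> ? ?]]]] _|].
  by exists (y :: w1), x, w2.
rewrite -all_predC orbF => H yp; exists [::], y, w; split=> //.
by apply: sub_all H => x /=; lia.
Qed.

(** The minima of [w] above [p] all lie after its last letter at most [p], where [w] is the end of
    [hi p w] shifted by [p]; so the count in [split_condE] is [nmin p w]. *)
Lemma split_cond_lomask m i p (w : seq nat) :
  0 < m -> i <= m -> lo p w != [::] -> m <= nmin 0 (hi p w) ->
  split_cond m i (lo p w) (hi p w) (lomask p w) = (minn m (nmin p w) == i).
Proof.
move=> m0 im; rewrite -has_filter => /lomask_split[w1 [x [w2 [Ew xp pw2]]]] mw.
have hi0 : all (ltn 0) (hi p w).
  by rewrite /hi all_map; apply/allP => y; rewrite mem_filter /=; lia.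
have Ew2 : lomask p w2 = nseq (size w2) false.
  elim: {Ew} w2 pw2 => //= y w2 IH /andP[py /IH ->].
  by rewrite [y <= p]leqNgt py.
have El : lomask p w = lomask p w1 ++ true :: nseq (size w2) false.
  by rewrite Ew /lomask map_cat /= xp -/(lomask p w2) Ew2.
have := is_shuffle_lomask p w; rewrite -hiK.
rewrite /is_shuffle_mask size_map -/(is_shuffle_mask _ (hi p w) _) El => M.
rewrite split_condE //; congr (minn m _ == i).
have -> : count (pred1 false) (lomask p w1) = size (hi p w1).
  rewrite /lomask /hi size_map size_filter count_map.
  by apply: eq_count => y /=; rewrite ltnNge; case: leqP.
have hc u v : hi p (u ++ v) = hi p u ++ hi p v by rewrite /hi filter_cat map_cat.
have w2p : map (addn p) (hi p w2) = w2 by rewrite hiK; apply/all_filterP.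
rewrite Ew nmin_suffix /= ?xp // hc drop_size_cat // ltnNge xp /= add0n.
rewrite -cat1s hc {1}/hi /= ltnNge xp /=.
by have := nmin_addn p 0 (hi p w2); rewrite w2p addn0 => ->.
Qed.

(** * Restrictions of m-permutations to value intervals *)

Definition multiset_upto (m n : nat) (w : seq nat) : Prop :=
  forall k, count_mem k w = (0 < k <= n) * m.

Definition deg (m : nat) (w : seq nat) := size w %/ m.

Lemma count_nseq_iota m a n k :
  count_mem k (flatten [seq nseq m j | j <- iota a n]) = (k \in iota a n) * m.
Proof.
elim: n a => [|n IH] a //=; rewrite count_cat IH count_nseq in_cons /= [a == k]eq_sym.
by case: eqP => [->|_] //=; rewrite mem_iota ltnn addn0.
Qed.

Lemma size_nseq_iota m a n :
  size (flatten [seq nseq m j | j <- iota a n]) = m * n.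
Proof. by elim: n a => [|n IH] a; rewrite ?muln0 //= size_cat size_nseq IH mulnS. Qed.

Lemma multiset_perm m n w : multiset_upto m n w ->
  perm_eq w (flatten [seq nseq m k | k <- iota 1 n]).
Proof.
move=> H; apply/allP => k _ /=; rewrite count_nseq_iota H mem_iota.
by rewrite add1n ltnS.
Qed.

Lemma multiset_deg m n w : 0 < m -> multiset_upto m n w -> deg m w = n.
Proof. by move=> m0 /multiset_perm/perm_size E; rewrite /deg E size_nseq_iota mulKn. Qed.

Lemma mpermP m w : 0 < m -> is_mperm m w ->
  0 < deg m w /\ multiset_upto m (deg m w) w.
Proof.
move=> m0 /(is_mpermP _ m0)[n n0 /permP pw].
have H : multiset_upto m n w.
  by move=> k; rewrite pw count_nseq_iota mem_iota add1n ltnS.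
by rewrite (multiset_deg m0 H).
Qed.

Lemma multiset_mperm m n w : 0 < m -> 0 < n -> multiset_upto m n w -> is_mperm m w.
Proof. by move=> m0 n0 H; apply/(is_mpermP _ m0); exists n => //; apply: multiset_perm. Qed.

Lemma multiset_all m n w : 0 < m -> multiset_upto m n w ->
  all (fun k => 0 < k <= n) w.
Proof.
move=> m0 H; apply/allP => k; rewrite -has_pred1 has_count H; by case: (_ && _).
Qed.

Lemma multiset_lo m n p w : p <= n -> multiset_upto m n w -> multiset_upto m p (lo p w).
Proof.
move=> pn H k; rewrite /lo count_filter.
case: (leqP k p) => kp.
  have := H k; rewrite (leq_trans kp pn) => <-; apply: eq_count => x /=.
  by case: eqP => //= ->.
rewrite andbF mul0n; apply/eqP; rewrite -leqn0 leqNgt -has_count; apply/hasPn => x _ /=.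
by apply/negP => /andP[/eqP ->]; rewrite leqNgt kp.
Qed.

Lemma hi_gt0 p w : all (ltn 0) (hi p w).
Proof. by rewrite /hi all_map; apply/allP => y; rewrite mem_filter /=; lia. Qed.

Lemma multiset_hi m n p w : multiset_upto m n w -> multiset_upto m (n - p) (hi p w).
Proof.
move=> H k; case: k => [|k].
  rewrite mul0n; apply/eqP; rewrite -leqn0 leqNgt -has_count; apply/hasPn => x.
  by move/(allP (hi_gt0 p w)); case: x.
have -> : (0 < k.+1 <= n - p) = (0 < p + k.+1 <= n) by lia.
rewrite -H.
rewrite /hi count_map count_filter; apply: eq_count => x /=; lia.
Qed.

Lemma lo_mperm m p w : 0 < m -> is_mperm m w -> 0 < p <= deg m w ->
  is_mperm m (lo p w) /\ deg m (lo p w) = p.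
Proof.
move=> m0 /(mpermP m0)[n0 H] /andP[p0 pn]; have H' := multiset_lo pn H.
by split; [apply: multiset_mperm H'|apply: multiset_deg H'].
Qed.

Lemma hi_mperm m p w : 0 < m -> is_mperm m w -> p < deg m w ->
  is_mperm m (hi p w) /\ deg m (hi p w) = deg m w - p.
Proof.
move=> m0 /(mpermP m0)[n0 H] pn; have H' := @multiset_hi _ _ p _ H.
by split; [apply: multiset_mperm H'; rewrite ?subn_gt0|apply: multiset_deg H'].
Qed.

Lemma mperm_letters m w : 0 < m -> is_mperm m w -> all (fun k => 0 < k <= deg m w) w.
Proof. by move=> m0 /(mpermP m0)[_ /(multiset_all m0)]. Qed.

Lemma mperm_pos m w : 0 < m -> is_mperm m w -> all (ltn 0) w.
Proof. by move=> m0 /(mperm_letters m0); apply: sub_all => k /andP[]. Qed.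

Lemma mperm_max m w : 0 < m -> is_mperm m w -> \max_(x <- w) x = deg m w.
Proof.
move=> m0 wP; apply/eqP; rewrite eqn_leq; apply/andP; split.
  apply/bigmax_leqP_seq => k kw _.
  by have /andP[] := allP (mperm_letters m0 wP) _ kw.
have [n0 /(_ (deg m w))] := mpermP m0 wP; rewrite n0 leqnn mul1n => E.
apply: (@bigmax_sup_seq _ _ (deg m w)) => //; rewrite -has_pred1 has_count E //.
Qed.

(** Among positive letters a 1 is always a right-to-left minimum; the [m] ones of an m-permutation
    thus give [mperm_nmin]. *)
Lemma nmin_ge_ones w : all (ltn 0) w -> count_mem 1 w <= nmin 0 w.
Proof.
elim: w => //= x w IH /andP[x0 w0]; apply: leq_add; last exact: IH.
case: eqP => //= ->; rewrite lt0b; apply/allP => y /(allP w0) //.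
Qed.

Lemma mperm_nmin m w : 0 < m -> is_mperm m w -> m <= nmin 0 w.
Proof.
move=> m0 wP; apply: leq_trans (nmin_ge_ones (mperm_pos m0 wP)).
by have [n0 ->] := mpermP m0 wP; rewrite n0 mul1n.
Qed.

Lemma mperm_neq0 m w : 0 < m -> is_mperm m w -> w != [::].
Proof. by move=> m0; case: w => // /(mpermP m0)[]; rewrite /deg div0n. Qed.

Lemma mperm_size m w : is_mperm m w -> size w = m * deg m w.
Proof. by case/and3P => _ /eqP. Qed.

(** * Normal monomials and their leading words *)

Section MonomialEq.
Variable m : nat.

(** Coding by generic trees provides decidable equality, required by the lists of monomials
    below. *)
Fixpoint mon_code (t : monomial m) : GenTree.tree 'I_m.+1 :=
  match t with
  | MGen => GenTree.Node 0 [::]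
  | MOp i s t => GenTree.Node 1 [:: GenTree.Leaf i; mon_code s; mon_code t]
  end.

Fixpoint mon_decode (c : GenTree.tree 'I_m.+1) : monomial m :=
  match c with
  | GenTree.Node 1 [:: GenTree.Leaf i; s; t] => MOp i (mon_decode s) (mon_decode t)
  | _ => MGen m
  end.

Lemma mon_codeK : cancel mon_code mon_decode.
Proof. by elim=> //= i s -> t ->. Qed.

HB.instance Definition _ := Equality.copy (monomial m) (can_type mon_codeK).

(** The bound [r] moves past each label down the right spine and starts afresh at 0 in left factors;
    at [r = m.+1] only the generator is left. *)
Fixpoint normal (r : nat) (t : monomial m) : bool :=
  if t is MOp i s t then [&& r <= i, normal 0 s & normal i.+1 t] else true.

Lemma normal_MOp r (i : 'I_m.+1) s t :
  normal r (MOp i s t) = [&& r <= i, normal 0 s & normal i.+1 t].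
Proof. by []. Qed.

Lemma normal_leq r r' t : r' <= r -> normal r t -> normal r' t.
Proof. by case: t => //= i s t rr /and3P[ri -> ->]; rewrite (leq_trans rr). Qed.

Lemma mon_degree_gt0 (t : monomial m) : 0 < mon_degree t.
Proof. by elim: t => //= i s H t _; rewrite addn_gt0 H. Qed.

End MonomialEq.

(** * Lexicographic order and endings of words *)

Fixpoint lexle (s t : seq nat) : bool :=
  match s, t with
  | x :: s', y :: t' => (x < y) || (x == y) && lexle s' t'
  | [::], _ => true
  | _ :: _, [::] => false
  end.

Lemma lexle_refl : reflexive lexle.
Proof. by elim=> //= x s ->; rewrite eqxx orbT. Qed.

Lemma lexle_anti : antisymmetric lexle.
Proof.
elim=> [|x s IH] [|y t] //= /andP[].
case: ltngtP => //= -> st ts; congr (_ :: _); apply: IH; by rewrite st ts.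
Qed.

Lemma lexle_total : total lexle.
Proof. by elim=> [|x s IH] [|y t] //=; case: ltngtP => //= _; apply: IH. Qed.

Lemma lexle_trans : transitive lexle.
Proof.
elim=> [|y t IH] [|x s] [|z r] //=.
case: (ltngtP x y) => //= [xy|->]; first by case: (ltngtP y z) => //= [yz|<-]; lia.
by case: (ltngtP y z) => //= _; apply: IH.
Qed.

Lemma lexle_cat s1 s2 t1 t2 : size s1 = size t1 ->
  lexle (s1 ++ s2) (t1 ++ t2) = lexle s1 t1 && ((s1 == t1) ==> lexle s2 t2).
Proof.
elim: s1 t1 => [|x s1 IH] [|y t1] //= [st]; rewrite eqseq_cons IH //.
by case: ltngtP.
Qed.

Lemma lexle_addn p s t : lexle (map (addn p) s) (map (addn p) t) = lexle s t.
Proof. by elim: s t => [|x s IH] [|y t] //=; rewrite IH ltn_add2l eqn_add2l. Qed.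

(** At the first change a letter at most [p] gives way to one above [p]. So the largest shuffle of
    two given factors has the whole right factor in front. *)
Lemma lexle_filter p w : lexle w ([seq x <- w | p < x] ++ lo p w).
Proof.
elim: w => //= x w IH; rewrite /lo /=; case: (ltnP p x) => px /=.
  by rewrite eqxx IH orbT.
case E : [seq y <- w | p < y] => [|y v] /=.
  by move: IH; rewrite E eqxx /= => ->; rewrite orbT.
have : y \in [seq y <- w | p < y] by rewrite E mem_head.
by rewrite mem_filter => /andP[py _]; rewrite (leq_ltn_trans px py).
Qed.

Lemma cat_injl (T : eqType) (u v w : seq T) : u ++ w = v ++ w -> u = v.
Proof.
move=> E; have /eqP := congr1 size E; rewrite !size_cat eqn_add2r => /eqP sz.
by move/eqP: E; rewrite eqseq_cat // => /andP[/eqP].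
Qed.

Definition ends (c k : nat) (w : seq nat) : Prop :=
  c <= size w /\ drop (size w - c) w = nseq c k.

Lemma ends_cat c k w : ends c k w <-> exists v, w = v ++ nseq c k.
Proof.
split=> [[cw E]|[v ->]].
  by exists (take (size w - c) w); rewrite -[LHS](cat_take_drop (size w - c)) E.
split; first by rewrite size_cat size_nseq leq_addl.
by rewrite size_cat size_nseq addnK drop_size_cat.
Qed.

Lemma ends_leq c c' k w : c' <= c -> ends c k w -> ends c' k w.
Proof.
move=> cc /ends_cat[v ->]; apply/ends_cat; exists (v ++ nseq (c - c') k).
by rewrite -catA -nseqD subnK.
Qed.

(** Everything from the leftmost minimum above [p] to the end of [w] exceeds [p], and this stretch
    contains all [nmin p w] minima. *)
Lemma nmin_all_gt p c w : c <= nmin p w ->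
  c <= size w /\ all (ltn p) (drop (size w - c) w).
Proof.
elim: w => [|x w IH] /=; first by case: c.
move=> cw; case: (leqP c (nmin p w)) => cw'.
  have [cs al] := IH cw'; split; first exact: leqW.
  by rewrite subSn.
have {}cw : c = (nmin p w).+1 /\ (p < x) && all (leq x) w by case: (_ && _) cw => /=; lia.
case: cw => -> /andP[px xw].
have pw : all (ltn p) (x :: w).
  by rewrite /= px; apply: sub_all xw => y; apply: leq_trans.
split; last by apply/allP => y /mem_drop /(allP pw).
rewrite ltnS; elim: {px xw pw cw' IH} w => //= y w; case: (_ && _) => /=; lia.
Qed.

Lemma nmin_nseq p c k : p < k -> nmin p (nseq c k) = c.
Proof. by move=> pk; elim: c => //= c ->; rewrite pk all_nseq leqnn orbT. Qed.

Lemma nmin_cat_lo p w v : all (geq p) w -> nmin p (w ++ v) = nmin p v.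
Proof. by elim: w => //= x w IH /andP[xp /IH ->]; rewrite ltnNge xp. Qed.

Lemma hi_cat p u v : hi p (u ++ v) = hi p u ++ hi p v.
Proof. by rewrite /hi filter_cat map_cat. Qed.

Lemma lo_cat p u v : lo p (u ++ v) = lo p u ++ lo p v.
Proof. exact: filter_cat. Qed.

Lemma lo_addn p w : all (ltn 0) w -> lo p (map (addn p) w) = [::].
Proof.
move=> w0; apply/eqP; rewrite -[_ == _]negbK -has_filter has_map.
by apply/hasPn => x /(allP w0) /=; lia.
Qed.

Lemma hi_addn p w : all (ltn 0) w -> hi p (map (addn p) w) = w.
Proof.
elim: w => //= x w IH /andP[x0 w0]; rewrite /hi /=.
have -> : p < p + x by lia.
by rewrite /= addKn -/(hi p _) IH.
Qed.

Lemma hi_lo p w : all (geq p) w -> hi p w = [::].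
Proof. by elim: w => //= x w IH /andP[xp /IH]; rewrite /hi /= ltnNge xp. Qed.

(** The last [c] letters of [w] exceed [p], so they come from [hi p w] and are forced; only [w1] is
    left to vary. *)
Lemma split_tail c k p w : c <= nmin p w -> ends c k (hi p w) ->
  exists w1, [/\ w = w1 ++ nseq c (p + k), hi p w = hi p w1 ++ nseq c k &
    lo p w = lo p w1].
Proof.
move=> /nmin_all_gt[cw wgt] /ends_cat[v hE].
set w1 := take (size w - c) w; set w2 := drop (size w - c) w in wgt.
have wE : w = w1 ++ w2 by rewrite cat_take_drop.
have sw2 : size w2 = c by rewrite size_drop subKn.
have h2 : hi p w2 = nseq c k.
  move: (hE) => /eqP; rewrite wE hi_cat eqseq_cat => [/andP[_ /eqP]//|].
  have := congr1 size hE; rewrite wE hi_cat !size_cat size_nseq.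
  rewrite [size (hi p w2)]size_map (all_filterP wgt) sw2; exact: addIn.
have w2E : w2 = nseq c (p + k).
  by have := hiK p w2; rewrite h2 map_nseq (all_filterP wgt) => <-.
exists w1; split; rewrite {1}wE ?w2E // -?w2E ?hi_cat ?h2 // lo_cat.
rewrite (_ : lo p w2 = [::]) ?cats0 //.
apply/eqP; rewrite -[_ == _]negbK -has_filter; apply/hasPn => y /(allP wgt) /=; lia.
Qed.

Lemma lexle_unshuffle p w s v : size (hi p w) = size v -> size (lo p w) = size s ->
  lexle (hi p w) v -> lexle (lo p w) s ->
  size w = size (map (addn p) v ++ s) /\ lexle w (map (addn p) v ++ s).
Proof.
move=> sv ss lv ls; split.
  rewrite size_cat size_map -sv -ss /hi size_map !size_filter.
  rewrite -(count_predC (leq^~ p) w) addnC; congr (_ + _).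
  by apply: eq_count => y /=; rewrite ltnNge.
apply: lexle_trans (lexle_filter p w) _.
by rewrite -(hiK p w) lexle_cat ?lexle_addn ?lv ?ls ?implybT // !size_map -sv size_map.
Qed.

Section Lead.
Variable m : nat.
Hypothesis m0 : 0 < m.

(** For a normal monomial the last [i] letters of the right factor equal its maximum; putting
    [lead s] just before them leaves exactly [i] minima to its right and all other large letters in
    front. *)
Fixpoint lead (t : monomial m) : seq nat :=
  match t with
  | MGen => nseq m 1
  | MOp i s t =>
    let v := map (addn (mon_degree s)) (lead t) in
    take (size v - i) v ++ lead s ++ drop (size v - i) v
  end.

Lemma lead_multiset t : multiset_upto m (mon_degree t) (lead t).
Proof.
elim: t => [|i s IHs t IHt] k /=.
  by rewrite count_nseq /=; case: k => [|[|k]].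
rewrite !count_cat addnCA -count_cat cat_take_drop IHs count_map.
set p := mon_degree s; set q := mon_degree t.
case: (leqP k p) => kp.
  rewrite (@eq_in_count _ _ pred0) ?count_pred0.
    by rewrite (leq_trans kp (leq_addr _ _)) addn0.
  move=> x /(allP (multiset_all m0 IHt)) /= /andP[x0 _]; apply/negbTE; lia.
rewrite andbF (eq_count (a2 := pred1 (k - p))) => [|x /=]; last by lia.
by rewrite add0n IHt; congr (nat_of_bool _ * _); lia.
Qed.

Lemma lead_mperm t : is_mperm m (lead t).
Proof. exact: multiset_mperm (mon_degree_gt0 t) (lead_multiset t). Qed.

Lemma deg_lead t : deg m (lead t) = mon_degree t.
Proof. exact: multiset_deg (lead_multiset t). Qed.

Lemma size_lead t : size (lead t) = m * mon_degree t.
Proof. by rewrite (mperm_size (lead_mperm t)) deg_lead. Qed.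

Lemma lead_letters t : all (fun k => 0 < k <= mon_degree t) (lead t).
Proof. exact: multiset_all (lead_multiset t). Qed.

Lemma lead_MOp (i : 'I_m.+1) s t : ends i (mon_degree t) (lead t) ->
  exists2 v, lead t = v ++ nseq i (mon_degree t) &
    lead (MOp i s t) = map (addn (mon_degree s)) v ++ lead s
      ++ nseq i (mon_degree s + mon_degree t).
Proof.
case/ends_cat => v E; exists v => //=.
rewrite E map_cat map_nseq size_cat size_nseq addnK size_map.
by rewrite take_size_cat ?drop_size_cat ?size_map.
Qed.

(** The right factor under a label [i] ends in min(i + 1, m) >= i copies of its maximum, so the
    insertion keeps [i >= r] of them at the end. The generator has only [m] letters, whence
    [minn r m]. *)
Lemma lead_ends r t : normal r t -> ends (minn r m) (mon_degree t) (lead t).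
Proof.
elim: t r => [|i s _ t IHt] r.
  by move=> _; apply: (@ends_leq m); [lia|apply/ends_cat; exists [::]].
case/and3P => ri _ nt; have := IHt _ nt => /(@ends_leq _ i).
case; first by have := ltn_ord i; lia.
move=> le1 le2; have [v _ ->] := lead_MOp s (conj le1 le2).
apply: (@ends_leq i); first by lia.
by apply/ends_cat; rewrite catA; eexists.
Qed.

Lemma lead_op_ends (i : 'I_m.+1) r s t : normal r (MOp i s t) ->
  ends i (mon_degree t) (lead t).
Proof.
by case/and3P => _ _ /lead_ends H; apply: ends_leq H; have := ltn_ord i; lia.
Qed.

Lemma lead_nmin (i : 'I_m.+1) r q s t : normal r (MOp i s t) ->
  mon_degree s <= q < mon_degree s + mon_degree t -> nmin q (lead (MOp i s t)) = i.
Proof.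
move=> nt /andP[sq qK]; have [v _ ->] := lead_MOp s (lead_op_ends nt).
have ls : all (geq q) (lead s).
  by apply: sub_all (lead_letters s) => x /andP[_ xs]; apply: leq_trans sq.
rewrite nmin_suffix ?nmin_cat_lo ?nmin_nseq //.
rewrite has_cat; apply/orP; left; move: ls (mperm_neq0 m0 (lead_mperm s)).
by case: (lead s) => //= x w /andP[->].
Qed.

(** The number of maxima ending the word gives the label. Once they are removed, the last remaining
    maximum, if any, closes the part [v] of the right factor, and [lead s] follows it. *)
Lemma lead_inj r r' t t' : normal r t -> normal r' t' -> lead t = lead t' -> t = t'.
Proof.
elim: t r r' t' => [|i s IHs t IHt] r r' t' nt nt' E.
  case: t' nt' E => // i' s' t' _ /(congr1 size); rewrite !size_lead /=.
  by have := mon_degree_gt0 s'; have := mon_degree_gt0 t'; nia.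
case: t' nt' E => [|i' s' t'] nt' E.
  move: E => /(congr1 size); rewrite !size_lead /=.
  by have := mon_degree_gt0 s; have := mon_degree_gt0 t; nia.
have dE : mon_degree s + mon_degree t = mon_degree s' + mon_degree t'.
  have := congr1 size E; rewrite !size_lead => /eqP.
  by rewrite eqn_pmul2l // => /eqP.
have iE : i = i' :> nat.
  (* One below the maximum, the threshold is in the range of [lead_nmin] for both trees, whatever
     the degrees of their left factors. *)
  have := congr1 (nmin (mon_degree s + mon_degree t).-1) E.
  by rewrite (lead_nmin nt) ?(lead_nmin nt') // ?dE;
     have := mon_degree_gt0 t; have := mon_degree_gt0 t'; lia.
have {iE} iE : i = i' by apply: val_inj.
subst i'; have [v vE wE] := lead_MOp s (lead_op_ends nt).
have [v' vE' wE'] := lead_MOp s' (lead_op_ends nt').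
case/and3P: (nt) => _ ns nt1; case/and3P: (nt') => _ ns' nt1'.
have deg_s : lead s = lead s' -> mon_degree s = mon_degree s' /\ mon_degree t = mon_degree t'.
  move=> ls; have ds : mon_degree s = mon_degree s' by rewrite -!deg_lead ls.
  by split=> //; lia.
have {E} E : map (addn (mon_degree s)) v ++ lead s = map (addn (mon_degree s')) v' ++ lead s'.
  by move: E; rewrite wE wE' dE !catA => /cat_injl.
have [ls vv] : lead s = lead s' /\ v = v'.
  (* If [i < m], then [lead t] ends in [i + 1] maxima, so [v] ends in one and [lead s] contains
     none; if [i = m], the right factor is the generator and [v] is empty. *)
  case: (ltnP i m) => im.
    have H t2 v2 : normal i.+1 t2 -> lead t2 = v2 ++ nseq i (mon_degree t2) ->
        exists y, v2 = rcons y (mon_degree t2).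
      move=> /lead_ends /(@ends_leq _ i.+1) H vE2.
      have /H /ends_cat[y] : i.+1 <= minn i.+1 m by lia.
      by rewrite vE2 -cat_rcons => /cat_injl ->; exists y.
    have [[y yE] [y' yE']] := (H _ _ nt1 vE, H _ _ nt1' vE').
    have nl s2 : mon_degree s2 < mon_degree s + mon_degree t ->
        mon_degree s + mon_degree t \notin lead s2.
      by move=> sK; apply/negP => /(allP (lead_letters s2)); lia.
    move/eqP: E; rewrite yE yE' !map_rcons -dE !cat_rcons eqseq_pivot2r; last first.
    - by apply: nl; have := mon_degree_gt0 t'; lia.
    - by apply: nl; have := mon_degree_gt0 t; lia.
    case/andP => /eqP yy /eqP ls; have [ds dt] := deg_s ls.
    split=> //; rewrite dt; congr rcons.
    by apply: (inj_map (@addnI (mon_degree s))); rewrite {2}ds.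
  have H t2 v2 : normal i.+1 t2 -> lead t2 = v2 ++ nseq i (mon_degree t2) -> v2 = [::].
    case: t2 => [_ /(congr1 size)|j ? ? /and3P[]]; last by have := ltn_ord j; lia.
    rewrite size_cat !size_nseq => sz; apply: size0nil; lia.
  by move: E; rewrite (H _ _ nt1 vE) (H _ _ nt1' vE').
have [ds dt] := deg_s ls.
rewrite (IHs 0 0 s') // (IHt i.+1 i.+1 t') //.
by rewrite vE vE' vv dt.
Qed.

End Lead.

(** * Counting normal monomials *)

(* Number of forests of [r] (possibly empty) (m+1)-ary trees with [n] nodes. *)
Fixpoint raney (m n : nat) : nat -> nat :=
  match n with
  | 0 => fun=> 1
  | n'.+1 => fix inner r :=
      if r is r'.+1 then inner r' + raney m n' (r' + m.+1) else 0
  end.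

Lemma raneyS m n r : raney m n.+1 r.+1 = raney m n.+1 r + raney m n (r + m.+1).
Proof. by []. Qed.

Lemma raney_convolution m n r s :
  raney m n (r + s) = \sum_(k < n.+1) raney m k r * raney m (n - k) s.
Proof.
elim: n r => [|n IHn] r; first by rewrite big_ord1.
elim: r => [|r IHr].
  by rewrite big_ord_recl big1 ?addn0 ?mul1n ?subn0.
rewrite addSn raneyS IHr addnAC IHn [X in X + _ = _]big_ord_recl [RHS]big_ord_recl.
rewrite -addnA; congr (_ + _).
rewrite -big_split /=; apply: eq_bigr => k _.
by rewrite /bump /= add1n subSS -mulnDl.
Qed.

(** With N = m (n + 1) + n + r, this is the Raney number r / (N + 1) C(N + 1, n + 1), rewritten as
    C(N, n + 1) - m C(N, n) and freed of subtraction. The recurrence then follows from Pascal's rule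
    on each binomial. *)
Lemma raney_binomial m n r :
  raney m n.+1 r + m * 'C(m * n.+1 + n + r, n) = 'C(m * n.+1 + n + r, n.+1).
Proof.
elim: n r => [|n IHn].
  elim=> [|r IHr]; first by rewrite [raney _ _ _]/= bin0 bin1; lia.
  move: IHr; rewrite raneyS [raney m 0 _]/= !bin0 !bin1; lia.
elim=> [|r IHr].
  (* For r = 0 the two binomials are proportional: (n + 2) C(N, n + 2) = (N - n - 1) C(N, n + 1),
     where N - n - 1 = m (n + 2). *)
  rewrite add0n addn0; apply/eqP; rewrite -(eqn_pmul2l (ltn0Sn n.+1)).
  by rewrite mul_bin_left addnK mulnA [n.+2 * m]mulnC.
have -> : m * n.+2 + n.+1 + r.+1 = (m * n.+2 + n.+1 + r).+1 by rewrite addnS.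
rewrite raneyS !binS mulnDr -IHr -(addnA (raney _ _ _)).
have := IHn (r + m.+1).
rewrite (_ : m * n.+1 + n + (r + m.+1) = m * n.+2 + n.+1 + r); last by lia.
lia.
Qed.

Lemma raney_fuss_catalan m n : raney m n 1 = fuss_catalan m n.
Proof.
case: n => [|n]; first by rewrite /fuss_catalan muln0 bin0.
rewrite /fuss_catalan; apply/esym/eqP.
rewrite -(eqn_pmul2r (ltn0Sn (m * n.+1))) divnK ?dvdn_fuss_catalan //.
have := raney_binomial m n 1; rewrite -addnA addn1.
have := mul_bin_left (m * n.+1 + n.+1) n.
have -> : m * n.+1 + n.+1 - n = (m * n.+1).+1 by lia.
set a := 'C(_, n); set b := 'C(_, n.+1) => E1 E2; apply/eqP; nia.
Qed.

Section Enumeration.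
Variable m : nat.

(* [f] is fuel; the right spine may use the last [r] labels, m+1-r up to m. *)
Fixpoint normals (f : nat) : nat -> nat -> seq (monomial m) :=
  match f with
  | 0 => fun _ _ => [::]
  | f'.+1 => fix inner r n :=
      match r with
      | 0 => if n == 1 then [:: MGen m] else [::]
      | r'.+1 => inner r' n ++
          flatten [seq [seq MOp (inord (m - r')) s t |
                          s <- normals f' m.+1 k, t <- normals f' r' (n - k)]
                  | k <- iota 1 n.-1]
      end
  end.

Lemma normalsS f r n : normals f.+1 r.+1 n = normals f.+1 r n ++
  flatten [seq [seq MOp (inord (m - r)) s t |
                  s <- normals f m.+1 k, t <- normals f r (n - k)]
          | k <- iota 1 n.-1].
Proof. by []. Qed.

Lemma mem_normals f r n t : n <= f -> r <= m.+1 ->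
  (t \in normals f r n) = normal (m.+1 - r) t && (mon_degree t == n).
Proof.
elim: f r n t => [|f IHf] r n t.
  rewrite leqn0 => /eqP -> _; rewrite in_nil; apply/esym/negbTE.
  by have := mon_degree_gt0 t; case: (mon_degree t) => // k _; rewrite andbF.
move=> nf; elim: r t => [|r IHr] t rm.
  rewrite subn0 /=; case: t => [|i s t] /=.
    by case: eqP => [->|]; rewrite // in_nil; case: eqP => // ->.
  have -> : (m < i) = false by rewrite ltnNge -ltnS ltn_ord.
  by case: (n == 1).
have rm' := ltnW rm; rewrite normalsS mem_cat IHr // subSS subSn //.
set E := (X in _ || X).
(* The block added at this stage holds the monomials whose root label is exactly [m - r], the
   smallest one now allowed. *)
have -> : E = if t is MOp i u v then
    [&& i == m - r :> nat, normal 0 u, normal (m - r).+1 v & mon_degree t == n] else false.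
  have iE : (inord (m - r) : 'I_m.+1) = m - r :> nat by rewrite inordK // ltnS leq_subr.
  rewrite /E; apply/flattenP/idP => [[l /mapP[k kn ->] /allpairsP[[u v] /= [uk vk ->]]]|].
    rewrite mem_iota in kn.
    have [k1 k2] : k <= f /\ n - k <= f by lia.
    move: uk vk; rewrite !IHf // subnn subSn // iE eqxx [mon_degree (MOp _ _ _)]/=.
    by move=> /andP[-> /eqP->] /andP[-> /eqP->]; rewrite subnKC ?eqxx //; lia.
  case: t {E IHr} => // i u v /and4P[/eqP iE' nu nv /eqP dn].
  have u0 := mon_degree_gt0 u; have v0 := mon_degree_gt0 v; rewrite /= in dn.
  exists [seq MOp (inord (m - r)) s t | s <- normals f m.+1 (mon_degree u),
      t <- normals f r (n - mon_degree u)].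
    by apply: map_f; rewrite mem_iota; lia.
  have -> : i = inord (m - r) by apply: val_inj; rewrite /= iE.
  apply: allpairs_f; rewrite IHf //; try lia.
    by rewrite subnn nu eqxx.
  by rewrite subSn // nv -dn addKn eqxx.
case: t {E} => [|i u v]; first by rewrite orbF.
rewrite /=; by case: (ltngtP (m - r) i) => [||->] //=; rewrite ?orbF ?andbA.
Qed.

(** The function [g] reads off a member the index of its block, so the blocks are disjoint. *)
Lemma uniq_flatten_map (T I : eqType) (F : I -> seq T) (g : T -> I) r :
  uniq r -> {in r, forall i, uniq (F i)} ->
  {in r, forall i x, x \in F i -> g x = i} -> uniq (flatten (map F r)).
Proof.
elim: r => //= i r IH /andP[ir ur] uF gF.
rewrite cat_uniq uF ?mem_head // IH // => [|j jr|j jr]; last 2 first.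
- by rewrite uF // in_cons jr orbT.
- by apply: gF; rewrite in_cons jr orbT.
rewrite andbT /=; apply/hasPn => x /flattenP[l /mapP[j jr ->]] xj.
apply/negP => /(gF _ (mem_head _ _)) gi.
by rewrite -gi (gF j) // ?jr ?in_cons ?jr ?orbT // in ir.
Qed.

Lemma uniq_normals f r n : n <= f -> r <= m.+1 -> uniq (normals f r n).
Proof.
elim: f r n => [|f IHf] // r n nf; elim: r => [|r IHr] rm.
  by rewrite /=; case: (n == 1).
have rm' := ltnW rm; rewrite normalsS cat_uniq IHr // andTb.
pose lab (t : monomial m) : nat := if t is MOp i _ _ then i else m.+1.
pose ldeg (t : monomial m) := if t is MOp _ u _ then mon_degree u else 0.
have iE : (inord (m - r) : 'I_m.+1) = m - r :> nat by rewrite inordK // ltnS leq_subr.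
apply/andP; split.
  apply/hasPn => t /flattenP[l /mapP[k kn ->] /allpairsP[[u v] /= [_ _ ->]]].
  apply/negP => H; have {H} : MOp (inord (m - r)) u v \in normals f.+1 r n := H.
  by rewrite mem_normals // normal_MOp iE subSn // ltnn.
apply: (@uniq_flatten_map _ _ _ ldeg); first exact: iota_uniq.
  move=> k; rewrite mem_iota => kn; apply: allpairs_uniq.
  - by apply: IHf => //; lia.
  - by apply: IHf; lia.
  by move=> [u v] [u' v'] _ _ /= [-> ->].
move=> k; rewrite mem_iota => kn t; have kf : k <= f by lia.
by case/allpairsP => -[u v] /= [uk _ ->]; move: uk; rewrite mem_normals // => /andP[_ /eqP].
Qed.

(** A monomial of degree [n.+1] has [n] operations, the nodes counted by [raney]. Below a new root
    the left factor may use all [m.+1] labels and the right one the last [r]; by the convolution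
    they count together as a forest of [r + m.+1] trees. *)
Lemma size_normals f r n : n < f -> r <= m.+1 -> size (normals f r n.+1) = raney m n r.
Proof.
elim: f r n => [|f IHf] // r n nf; elim: r => [|r IHr] rm; first by case: n {nf}.
rewrite normalsS size_cat IHr ?(ltnW rm) // size_flatten /shape -map_comp.
case: n nf {IHr} => [|n] nf; first by rewrite addn0.
rewrite raneyS; congr (_ + _); rewrite addnC raney_convolution sumnE big_map.
rewrite -[iota 1 _]/(index_iota 1 n.+2) big_add1 /= big_mkord; apply: eq_bigr => k _.
have kn : k <= n by rewrite -ltnS ltn_ord.
have kf : k < f by apply: leq_ltn_trans kn _.
have nkf : n - k < f by apply: leq_ltn_trans (leq_subr _ _) _.
by rewrite size_allpairs subSS subSn // !IHf // ltnW.
Qed.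

End Enumeration.
Local Open Scope ring_scope.

(** * Coefficients of the operations of mFQSym *)

Section Coef.
Variables (K : fieldType) (m : nat).
Hypothesis m0 : (0 < m)%N.
Notation M := (mFQSym K m).

(** Indexing by bare words, with value 0 off the m-permutations, lets [lo p w] and [hi p w] be used
    without proofs attached. *)
Definition wcoef (u : M) (w : seq nat) : K :=
  if insub w is Some g then mcoeff (g : mperm m) u else 0.

Lemma wcoefD w u v : wcoef (u + v) w = wcoef u w + wcoef v w.
Proof. by rewrite /wcoef; case: insub => [g|]; rewrite ?addr0 //; exact: mcoeffD. Qed.

Lemma wcoefZ w a u : wcoef (a *: u) w = a * wcoef u w.
Proof. by rewrite /wcoef; case: insub => [g|]; rewrite ?mulr0 //; exact: mcoeffZ. Qed.

Lemma wcoef0 w : wcoef 0 w = 0.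
Proof. by rewrite -(scale0r 0) wcoefZ mul0r. Qed.

Lemma wcoef_sum w I (r : seq I) (P : pred I) (F : I -> M) :
  wcoef (\sum_(i <- r | P i) F i) w = \sum_(i <- r | P i) wcoef (F i) w.
Proof. exact: (big_morph _ (wcoefD w) (wcoef0 w)). Qed.

Lemma wcoef_out u w : ~~ is_mperm m w -> wcoef u w = 0.
Proof. by move=> wP; rewrite /wcoef insubN. Qed.

Lemma wcoefP (u v : M) :
  (forall w, is_mperm m w -> wcoef u w = wcoef v w) -> u = v.
Proof.
move=> H; apply/malgP => g; have := H _ (valP g).
by rewrite /wcoef valK.
Qed.

Lemma wcoef_mF s w : is_mperm m w -> is_mperm m s -> wcoef (mF K m s) w = (s == w)%:R.
Proof.
move=> wP sP; rewrite /wcoef /mF !insubT /= mcoeffU.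
by rewrite -(inj_eq val_inj).
Qed.

Lemma wcoef_support (u : M) w :
  wcoef u w = \sum_(s <- msupp u) mcoeff s u * (w == mperm_val s)%:R.
Proof.
rewrite /wcoef; case: insubP => [g _ <-|wP]; last first.
  rewrite big1 // => s _; case: eqP => [E|]; last by rewrite mulr0.
  by case/negP: wP; rewrite E; exact: (valP s).
have E s : (val g == mperm_val s) = (s == g) by rewrite (inj_eq val_inj) eq_sym.
case: (boolP (g \in msupp u)) => gu.
  rewrite (bigD1_seq g) ?fset_uniq //= E eqxx mulr1 big1 ?addr0 // => s sg.
  by rewrite E (negbTE sg) mulr0.
rewrite (mcoeff_outdom gu) big_seq big1 // => s su.
rewrite E; case: eqP => [sg|]; last by rewrite mulr0.
by rewrite -sg su in gu.
Qed.

Definition idx (p : nat) (w : seq nat) := minn m (nmin p w).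

(** Only the mask [lomask p w] can produce [w], by [shuffle_filter], and [split_cond_lomask] tells
    which operation it belongs to. *)
Lemma wcoef_mF_op (i : 'I_m.+1) (s t : mperm m) w : is_mperm m w ->
  let p := deg m (mperm_val s) in
  wcoef (mF_op K i s t) w =
  [&& lo p w == mperm_val s, hi p w == mperm_val t & idx p w == i]%:R.
Proof.
move=> wP; case: s => s sP; case: t => t tP /=; set p := deg m s.
rewrite /mF_op /= wcoef_sum.
have tE : shift s t = map (addn p) t by rewrite /shift (mperm_max m0 sP).
have sp : all (geq p) s.
  by apply: sub_all (mperm_letters m0 sP) => x /andP[].
have tp : all (ltn p) (shift s t).
  rewrite tE all_map; apply: sub_all (mperm_pos m0 tP) => x /=; lia.
have maskE b : is_shuffle_mask s t b = is_shuffle_mask s (shift s t) b.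
  by rewrite /is_shuffle_mask tE size_map.
have tK : forall v, [seq x <- v | (p < x)%N] = shift s t -> hi p v = t.
  move=> v E; rewrite /hi E tE -map_comp -[RHS]map_id; apply: eq_map => x /=; lia.
rewrite (eq_bigr (fun b => (shuffle (tval b) s (shift s t) == w)%:R)); last first.
  by move=> b /andP[bP _]; rewrite wcoef_mF //; apply: shuffle_mperm.
case: (boolP [&& _, _ & _]) => [/and3P[/eqP lE /eqP hE /eqP iE]|N]; last first.
  rewrite big1 // => b /andP[]; rewrite maskE => bP sb.
  case: eqP => // wE; case/negP: N.
  have [E1 E2 E3] := shuffle_filter bP sp tp; rewrite wE in E1 E2 E3.
  have hE := tK _ E2; rewrite E1 hE !eqxx /=.
  have := @split_cond_lomask m i p w m0; rewrite E1 E3 hE -ltnS ltn_ord.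
  by move=> <-; rewrite ?(mperm_neq0 m0) ?mperm_nmin.
have := is_shuffle_lomask p w; rewrite -hiK lE hE -tE -maskE => Mp.
have /eqP sz : size (lomask p w) = (size s + size t)%N by case/andP: Mp => /eqP.
rewrite (bigD1 (Tuple sz)) /=; last first.
  have := @split_cond_lomask m i p w m0; rewrite lE hE -ltnS ltn_ord Mp.
  by move=> ->; rewrite ?(mperm_neq0 m0) ?mperm_nmin //; apply/eqP.
have := shuffle_lomask p w; rewrite -hiK lE hE -tE => ->; rewrite eqxx.
rewrite big1 ?addr0 // => b /andP[/andP[]]; rewrite maskE => bP _ bN.
case: eqP => // wE; case/eqP: bN; apply/val_inj => /=.
by have [_ _] := shuffle_filter bP sp tp; rewrite wE.
Qed.

Lemma wcoef_op (i : 'I_m.+1) (u v : M) w : is_mperm m w ->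
  wcoef (mFQSym_op i u v) w =
  \sum_(1 <= p < deg m w | idx p w == i) wcoef u (lo p w) * wcoef v (hi p w).
Proof.
move=> wP; rewrite /mFQSym_op wcoef_sum.
under eq_bigr => s _ do rewrite wcoef_sum.
transitivity (\sum_(s <- msupp u) \sum_(t <- msupp v)
   \sum_(1 <= p < deg m w | idx p w == i)
     (mcoeff s u * mcoeff t v) * [&& lo p w == mperm_val s & hi p w == mperm_val t]%:R);
  last first.
  under eq_bigr => s _ do rewrite exchange_big /=.
  rewrite exchange_big /=; apply: eq_bigr => p _; rewrite !wcoef_support big_distrl /=.
  apply: eq_bigr => s _; rewrite big_distrr /=; apply: eq_bigr => t _.
  by rewrite mulrACA -natrM mulnb.
apply: eq_bigr => s _; apply: eq_bigr => t _.
rewrite wcoefZ wcoef_mF_op // -mulr_sumr; congr (_ * _).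
have sP : is_mperm m (mperm_val s) := valP s.
have tP : is_mperm m (mperm_val t) := valP t.
set d := deg m (mperm_val s).
have d0 : (0 < d)%N by have [] := mpermP m0 sP.
(* Only the threshold [d] can contribute for this [s], because [lo p w] has degree [p]. *)
have H p : (1 <= p < deg m w)%N -> p != d -> (lo p w == mperm_val s) = false.
  move=> /andP[p1 pw] pd; apply/negP => /eqP E; case/eqP: pd.
  have pw' : (1 <= p <= deg m w)%N by rewrite p1 ltnW.
  by have [_] := lo_mperm m0 wP pw'; rewrite E -/d => <-.
case: (ltnP d (deg m w)) => dw; last first.
  rewrite big_nat_cond big1 => [|p /andP[/andP[p1 pw] _]]; last first.
    by rewrite H ?p1 //; lia.
  have -> : hi d w == mperm_val t = false.
    apply/negP => /eqP E; have := mperm_neq0 m0 tP; rewrite -E.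
    suff -> : hi d w = [::] by [].
    have : [seq x <- w | (d < x)%N] = [::].
      apply/eqP; rewrite -[_ == _]negbK -has_filter; apply/hasPn => x.
      by move=> /(allP (mperm_letters m0 wP)); lia.
    by rewrite /hi => ->.
  by rewrite andbF.
rewrite big_mkcond (bigD1_seq d) ?iota_uniq ?mem_index_iota ?d0 //=.
rewrite big_seq_cond big1 => [|p]; last first.
  by rewrite mem_index_iota => /andP[p1 pd]; rewrite H ?if_same.
rewrite addr0; case: (idx d w == i); by rewrite ?andbT ?andbF.
Qed.

End Coef.

Section LinearMaps.
Variables (K : fieldType) (V W : lmodType K) (f : V -> W).
Hypothesis fL : linear f.

Lemma lin0 : f 0 = 0.
Proof. by have := fL (-1) 0 0; rewrite scaler0 addr0 scaleN1r addNr. Qed.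

Lemma linD u v : f (u + v) = f u + f v.
Proof. by have := fL 1 u v; rewrite !scale1r. Qed.

Lemma linZ a u : f (a *: u) = a *: f u.
Proof. by have := fL a u 0; rewrite !addr0 lin0 addr0. Qed.

Lemma lin_sum I (r : seq I) (P : pred I) (F : I -> V) :
  f (\sum_(i <- r | P i) F i) = \sum_(i <- r | P i) f (F i).
Proof. exact: (big_morph _ linD lin0). Qed.

End LinearMaps.

(** * A uniform form of the dendriform relations *)

Section Unified.
Variables (K : fieldType) (m : nat) (V : lmodType K) (op : 'I_m.+1 -> V -> V -> V).
Hypothesis m0 : (0 < m)%N.

(** With prec as index 0 and succ as index [m] the relations merge: [ud_prec] is [dend1] for [i = 0]
    and [dend4] otherwise; [ud_succ] is [dend3] for [i = 0], [dend5] for [i = m] and [dend6] in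
    between; [ud_mid] is [dend2] for [i = 0] and [dend7] otherwise. *)
Record unified_dendriform : Prop := UnifiedDendriform {
  ud_linearr : forall i u, linear (op i u);
  ud_linearl : forall i v, linear ((op i)^~ v);
  ud_prec : forall i : 'I_m.+1, (i < m)%N -> forall u v w,
    op i (op ord0 u v) w = op i u (\sum_(j < m.+1 | (i <= j)%N) op j v w);
  ud_succ : forall i : 'I_m.+1, forall u v w,
    op i (\sum_(j < m.+1 | (m - i <= j)%N) op j u v) w = op ord_max u (op i v w);
  ud_mid : forall i k l : 'I_m.+1, (0 < k)%N -> l = (k + i)%N :> nat -> (l < m)%N ->
    forall u v w, op i (op k u v) w = op l u (op i v w)
}.

Lemma sum_from (c : nat) (F : 'I_m.+1 -> V) : (0 < c <= m)%N ->
  \sum_(j < m.+1 | (c <= j)%N) F j =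
  F ord_max + \sum_(j < m.+1 | (0 < j < m)%N && (c <= j)%N) F j.
Proof.
move=> /andP[c0 cm]; rewrite (bigD1 ord_max) //=; congr (_ + _).
apply: eq_bigl => j; have := ltn_ord j; rewrite -(inj_eq val_inj) /=; lia.
Qed.

Lemma dendriform_unified : is_dendriform op <-> unified_dendriform.
Proof.
split=> [H|H].
  have lr := dend_linearr H; have ll := dend_linearl H.
  split=> //.
  - move=> i im u v w; case: (posnP i) => i0.
      have -> : i = ord0 by apply: val_inj.
      by rewrite (dend1 H); congr (op _ u _); apply: eq_bigl.
    by rewrite (dend4 H) ?i0 // sum_from // i0 ltnW.
  - move=> i u v w; case: (posnP i) => i0.
      have -> : i = ord0 by apply: val_inj.
      rewrite -(dend3 H); congr (op _ _ w); rewrite (big_pred1 ord_max) // => j.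
      rewrite subn0 /= -val_eqE /=; have := ltn_ord j; lia.
    case: (ltnP i m) => im.
      by rewrite -(dend6 H) ?i0 // sum_from //; lia.
    have -> : i = ord_max by apply/val_inj => /=; have := ltn_ord i; lia.
    rewrite -(dend5 H); congr (op _ _ w).
    by apply: eq_bigl => j; rewrite subnn.
  - move=> i k l k0 lE lm u v w; case: (posnP i) => i0.
      have -> : l = k by apply/val_inj; rewrite /= lE i0 addn0.
      have -> : i = ord0 by apply: val_inj.
      by rewrite (dend2 H) // k0; lia.
    have im : (0 < i < m)%N by rewrite i0; lia.
    have km : (0 < k < m)%N by rewrite k0; lia.
    rewrite (dend7 H) // -?lE //; congr (op _ _ _).
    by apply/val_inj; rewrite /= inordK // ltn_ord.
have lr := ud_linearr H; have ll := ud_linearl H.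
split=> //.
- move=> u v w; rewrite (ud_prec H) //; congr (op _ u _); exact: eq_bigl.
- by move=> i /andP[i0 im] u v w; rewrite (ud_mid H (l := i)) ?addn0.
- move=> u v w; rewrite -(ud_succ H); congr (op _ _ w).
  rewrite (big_pred1 ord_max) // => j.
  by rewrite subn0 /= -val_eqE /=; have := ltn_ord j; lia.
- by move=> i /andP[i0 im] u v w; rewrite (ud_prec H) // sum_from // i0 ltnW.
- move=> u v w; rewrite -(ud_succ H); congr (op _ _ w).
  by apply: eq_bigl => j; rewrite subnn.
- by move=> i /andP[i0 im] u v w; rewrite -(ud_succ H) sum_from //; lia.
move=> i k /andP[i0 im] /andP[k0 km] ki u v w; apply: (ud_mid H) => //.
  by rewrite inordK // ltnS ltnW.
by rewrite inordK // ltnS ltnW.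
Qed.

End Unified.

(* [cf u w] stands for the coefficient of F_w in u.  In its dual form [cm_op],
   the product cuts the values of w at a threshold p, and the last letter of the
   left factor falls in the gap counted by [idx m p w]. *)
Record coef_model (K : fieldType) (m : nat) (M : lmodType K)
    (op : 'I_m.+1 -> M -> M -> M) (cf : M -> seq nat -> K) : Prop := CoefModel {
  cm_linear : forall w a u v, cf (a *: u + v) w = a * cf u w + cf v w;
  cm_out : forall u w, ~~ is_mperm m w -> cf u w = 0;
  cm_ext : forall u v, (forall w, is_mperm m w -> cf u w = cf v w) -> u = v;
  cm_op : forall i u v w, is_mperm m w -> cf (op i u v) w =
    \sum_(1 <= p < deg m w | idx m p w == i) cf u (lo p w) * cf v (hi p w)
}.

(** * The dendriform relations in a coefficient model *)

Section ModelDendriform.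
Variables (K : fieldType) (m : nat) (M : lmodType K).
Variables (op : 'I_m.+1 -> M -> M -> M) (cf : M -> seq nat -> K).
Hypothesis m0 : (0 < m)%N.
Hypothesis model : coef_model op cf.

Lemma cf0 w : cf 0 w = 0.
Proof. by have := cm_linear model w (-1) 0 0; rewrite scaler0 addr0 mulN1r addNr. Qed.

Lemma cfD w u v : cf (u + v) w = cf u w + cf v w.
Proof. by have := cm_linear model w 1 u v; rewrite scale1r mul1r. Qed.

Lemma cfZ w a u : cf (a *: u) w = a * cf u w.
Proof. by have := cm_linear model w a u 0; rewrite !addr0 cf0 addr0. Qed.

Lemma cf_sum w I (r : seq I) (P : pred I) (F : I -> M) :
  cf (\sum_(i <- r | P i) F i) w = \sum_(i <- r | P i) cf (F i) w.
Proof. exact: (big_morph _ (cfD w) (cf0 w)). Qed.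

Lemma model_linearr i u : linear (op i u).
Proof.
move=> a v w; apply: (cm_ext model) => g gP.
rewrite cfD cfZ !(cm_op model) // big_distrr -big_split.
by apply: eq_bigr => p _ /=; rewrite cfD cfZ mulrDr mulrCA.
Qed.

Lemma model_linearl i v : linear ((op i)^~ v).
Proof.
move=> a u w; apply: (cm_ext model) => g gP.
rewrite cfD cfZ !(cm_op model) // big_distrr -big_split.
by apply: eq_bigr => p _ /=; rewrite cfD cfZ mulrDl mulrA.
Qed.

(** Two thresholds p < q cut [g] into three words. Both bracketings of a triple product are sums of
    these same terms and differ only in the condition [P] of [sum3]. *)
Definition cf3 (u v w : M) (g : seq nat) (p q : nat) : K :=
  cf u (lo p g) * cf v (hi p (lo q g)) * cf w (hi q g).

Definition sum3 (P : nat -> nat -> bool) (u v w : M) (g : seq nat) : K :=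
  \sum_(1 <= q < deg m g) \sum_(1 <= p < q) (P p q)%:R * cf3 u v w g p q.

Lemma cf_op_l (i k : 'I_m.+1) u v w g : is_mperm m g ->
  cf (op i (op k u v) w) g =
  sum3 (fun p q => (idx m p (lo q g) == k) && (idx m q g == i)) u v w g.
Proof.
move=> gP; rewrite (cm_op model) // big_mkcond; apply: eq_big_nat => q /andP[q1 qn].
have qn' : (1 <= q <= deg m g)%N by rewrite q1 ltnW.
have [lP ldeg] := lo_mperm m0 gP qn'.
case: (idx m q g == i); last first.
  by rewrite big1 // => p _; rewrite andbF mul0r.
rewrite (cm_op model) // ldeg big_mkcond big_distrl /=.
apply: eq_big_nat => p /andP[p1 pq]; rewrite andbT.
case: (_ == _); last by rewrite !mul0r.
by rewrite mul1r /cf3 lo_lo // ltnW.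
Qed.

Lemma cf_op_r (i k : 'I_m.+1) u v w g : is_mperm m g ->
  cf (op i u (op k v w)) g =
  sum3 (fun p q => (idx m p g == i) && (idx m (q - p) (hi p g) == k)) u v w g.
Proof.
move=> gP; rewrite (cm_op model) // big_mkcond.
set P := (X in sum3 X); rewrite /sum3; set n := deg m g.
(* Here the outer cut is [p] and the inner one is q - p in [hi p g], so the sums are exchanged and
   the inner variable is shifted by [p]. *)
transitivity (\sum_(1 <= p < n) \sum_(1 <= q < n | (p < q)%N)
    (P p q)%:R * cf3 u v w g p q); last first.
  rewrite (exchange_big_dep_nat xpredT) //=; apply: eq_big_nat => q /andP[q1 qn].
  rewrite [RHS](big_nat_widen _ _ n) ?(ltnW qn) //.
apply: eq_big_nat => p /andP[p1 pn].
have [hP hdeg] := hi_mperm m0 gP pn.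
transitivity (\sum_(p.+1 <= q < n) (P p q)%:R * cf3 u v w g p q); last first.
  by rewrite (big_nat_widenl p.+1 1).
rewrite /P.
case: (idx m p g == i); last by rewrite big1 // => q _; rewrite mul0r.
rewrite (cm_op model) // hdeg big_mkcond big_distrr /= -/n.
rewrite -[p.+1]add1n -{1}(subnK (ltnW pn)) big_addn addnK.
apply: eq_big_nat => q /andP[q1 qn]; rewrite addnK.
case: (_ == _); last by rewrite mulr0 mul0r.
have := lo_hi g (leq_addl q p); have := hi_hi g (leq_addl q p).
by rewrite addnK mul1r /cf3 mulrA => -> ->.
Qed.

(** Each pair (p, q) is counted for the single label [A p q]. *)
Lemma sum3_indicator (A : nat -> nat -> nat) (P : nat -> bool) (B : nat -> nat -> bool) u v w g :
  (forall p q, (A p q <= m)%N) ->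
  \sum_(k < m.+1 | P k) sum3 (fun p q => (A p q == k) && B p q) u v w g =
  sum3 (fun p q => P (A p q) && B p q) u v w g.
Proof.
move=> Am; rewrite exchange_big /=; apply: eq_bigr => q _.
rewrite exchange_big /=; apply: eq_bigr => p _; rewrite -mulr_suml; congr (_ * _).
case: (boolP (P _)) => PA /=; last first.
  rewrite big1 // => k Pk; case: eqP => //= E; by rewrite E Pk in PA.
have Am' := Am p q; rewrite -ltnS in Am'.
rewrite (bigD1 (Ordinal Am')) //= eqxx big1 ?addr0 // => k /andP[_].
by rewrite -val_eqE eq_sym /= => /negbTE ->.
Qed.

Lemma idx_le p w : (idx m p w <= m)%N. Proof. exact: geq_minl. Qed.

(** The facts on minima truncated at [m]: additivity, the inequality, and its case of equality. *)
Lemma idx_cases p q g : (p <= q)%N ->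
  [/\ idx m p g = minn m (idx m q g + idx m p (lo q g)),
      (idx m q g <= idx m (q - p) (hi p g))%N &
      (0 < idx m p (lo q g))%N -> idx m (q - p) (hi p g) = idx m q g].
Proof.
move=> pq; rewrite /idx.
have := nmin_lo g pq; have := nmin_hi_geq g pq; have := @nmin_hi_eq p q g pq.
move: (nmin p g) (nmin q g) (nmin (q - p) _) (nmin p (lo q g)) => x y z t.
by move=> H yz ->; split; try lia.
Qed.

Lemma eq_sum3 P Q u v w g :
  (forall p q, (1 <= p < q)%N -> (q < deg m g)%N -> P p q = Q p q) ->
  sum3 P u v w g = sum3 Q u v w g.
Proof.
move=> H; apply: eq_big_nat => q /andP[q1 qn]; apply: eq_big_nat => p pq.
by rewrite H.
Qed.

(** Let e, a, d be the indices of q in [g], of p in [lo q g] and of q - p in [hi p g]. By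
    [idx_cases] each relation becomes an equivalence of conditions on e, a, d, where e <= d, and d =
    e as soon as a > 0. *)
Lemma model_unified : unified_dendriform op.
Proof.
have lr := model_linearr; have ll := model_linearl.
split=> //.
- move=> i im u v w; apply: (cm_ext model) => g gP.
  rewrite (lin_sum (lr _ _)) cf_sum cf_op_l //.
  under [RHS]eq_bigr => j _ do rewrite cf_op_r //.
  under [RHS]eq_bigr => j _.
    rewrite (_ : sum3 _ _ _ _ _ = sum3 (fun p q =>
      (idx m (q - p) (hi p g) == j) && (idx m p g == i)) u v w g); last first.
      by apply: eq_sum3 => *; rewrite andbC.
    over.
  rewrite (@sum3_indicator (fun p q => idx m (q - p) (hi p g)) (fun j => i <= j)%N).
    (* Here a = 0 and e = i is compared with min(m, e + a) = i and d >= i: as i < m, a > 0 would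
       give d = e < i. *)
    apply: eq_sum3 => p q /andP[p1 pq] _; have [-> ed da] := idx_cases g (ltnW pq).
    move: ed da (idx_le p (lo q g)) (idx_le q g) (idx_le (q - p) (hi p g)).
    move: (idx m q g) (idx m p _) (idx m (q - p) _) => e a d /= *; apply/idP/idP; lia.
  by move=> *; apply: idx_le.
- move=> i u v w; apply: (cm_ext model) => g gP.
  rewrite (lin_sum (ll _ _)) cf_sum cf_op_r //.
  under [LHS]eq_bigr => j _ do rewrite cf_op_l //.
  rewrite (@sum3_indicator (fun p q => idx m p (lo q g)) (fun j => m - i <= j)%N).
    (* Here a >= m - i and e = i is compared with e + a >= m and d = i; if a = 0, each side forces i
       = m. *)
    apply: eq_sum3 => p q /andP[p1 pq] _; have [-> ed da] := idx_cases g (ltnW pq).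
    move: ed da (idx_le p (lo q g)) (idx_le q g) (idx_le (q - p) (hi p g)) (ltn_ord i).
    move: (idx m q g) (idx m p _) (idx m (q - p) _) => e a d /= *; apply/idP/idP; lia.
  by move=> *; apply: idx_le.
move=> i k l k0 lE lm u v w; apply: (cm_ext model) => g gP.
rewrite cf_op_r // cf_op_l //; apply: eq_sum3 => p q /andP[p1 pq] _.
(* Here a = k and e = i is compared with e + a = k + i and d = i: e <= d = i gives a >= k > 0, hence
   e = d. *)
have [-> ed da] := idx_cases g (ltnW pq).
move: ed da (idx_le p (lo q g)) (idx_le q g) (idx_le (q - p) (hi p g)).
move: (idx m q g) (idx m p _) (idx m (q - p) _) => e a d /= *; apply/idP/idP; lia.
Qed.

End ModelDendriform.

Lemma mFQSym_model (K : fieldType) (m : nat) : (0 < m)%N ->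
  coef_model (@mFQSym_op K m) (@wcoef K m).
Proof.
move=> m0; split=> [w a u v|u w|u v|i u v w].
- by rewrite wcoefD wcoefZ.
- exact: wcoef_out.
- exact: wcoefP.
- exact: wcoef_op.
Qed.

(** * Linear independence of the normal monomials *)

Section Independence.
Variables (K : fieldType) (m : nat) (M : lmodType K).
Variables (op : 'I_m.+1 -> M -> M -> M) (cf : M -> seq nat -> K) (x : M).
Hypothesis m0 : (0 < m)%N.
Hypothesis model : coef_model op cf.
Hypothesis cf_x : forall w, is_mperm m w -> cf x w = (nseq m 1%N == w)%:R.

(** A nonzero term comes from the cut [p = mon_degree s]. The label makes the last [i] letters of
    [w] exceed [p], and by induction on the right factor they equal the maximum; on the rest, moving
    the right factor to the front can only increase the word. The claims on degree and ending feed
    the induction. *)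
Lemma cf_support r (t : monomial m) w : normal r t -> cf (mon_eval op x t) w != 0 ->
  [/\ is_mperm m w, deg m w = mon_degree t, ends (minn r m) (mon_degree t) w &
      lexle w (lead t)].
Proof.
elim: t r w => [|i s IHs t IHt] r w nt.
  move=> cw; have wP : is_mperm m w.
    by apply/negPn/negP => /(cm_out model) E; rewrite E eqxx in cw.
  move: cw; rewrite /= cf_x //; case: (nseq m 1%N =P w); last by rewrite eqxx.
  move=> E _; rewrite -E; split=> //; last exact: lexle_refl.
  - by rewrite E.
  - by rewrite /deg size_nseq divnn m0.
  by apply: (@ends_leq m); [lia|apply/ends_cat; exists [::]].
move=> cw; have wP : is_mperm m w.
  by apply/negPn/negP => /(cm_out model) E; rewrite E eqxx in cw.
case/and3P: (nt) => ri ns nt1.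
have [p [pw iE cs ct]] : exists p, [/\ (1 <= p < deg m w)%N, idx m p w = i,
    cf (mon_eval op x s) (lo p w) != 0 & cf (mon_eval op x t) (hi p w) != 0].
  move: cw; rewrite /= (cm_op model) // => cw.
  have /hasP[p] : has (fun p => (idx m p w == i) && (cf (mon_eval op x s) (lo p w) *
      cf (mon_eval op x t) (hi p w) != 0)) (index_iota 1 (deg m w)).
    apply/negPn/negP => /hasPn H; move/eqP: cw; apply.
    rewrite big_seq_cond big1 // => p /andP[pw ip]; apply/eqP.
    by have := H _ pw; rewrite ip /= negbK.
  rewrite mem_index_iota mulf_eq0 negb_or => pw /and3P[/eqP ip cs ct].
  by exists p.
have [p1 pn] := andP pw.
have [lP ldeg _ lle] := IHs _ _ ns cs.
have [hP hdeg hends hle] := IHt _ _ nt1 ct.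
have pE : p = mon_degree s.
  by rewrite -ldeg; have [] := @lo_mperm m p w m0 wP ltac:(by rewrite p1 ltnW).
have wdeg : deg m w = (mon_degree s + mon_degree t)%N.
  by have [_] := hi_mperm m0 wP pn; rewrite hdeg -pE => ->; rewrite subnKC // ltnW.
have im : (i <= minn i.+1 m)%N by rewrite leq_min leqnSn -ltnS ltn_ord.
have {}hends : ends i (mon_degree t) (hi p w) := ends_leq im hends.
have [|w1 [wE h1 l1]] := split_tail _ hends (p := p); first by rewrite -iE geq_minr.
split=> //.
  apply: (@ends_leq i); first by rewrite geq_min ri.
  by apply/ends_cat; exists w1; rewrite wE pE.
have [v vE ->] := lead_MOp s (lead_op_ends m0 nt).
rewrite wE pE catA.
have szv : size (hi p w1) = size v.
  have : size (hi p w) = size (lead t) by rewrite (mperm_size hP) hdeg size_lead.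
  by rewrite h1 vE !size_cat => /addIn.
have szs : size (lo p w1) = size (lead s).
  by rewrite -l1 (mperm_size lP) ldeg size_lead.
have hle1 : lexle (hi p w1) v.
  by move: hle; rewrite h1 vE lexle_cat // => /andP[].
have [szw lew] := lexle_unshuffle szv szs hle1 (etrans (congr1 (lexle^~ _) (esym l1)) lle).
by rewrite lexle_cat -pE // lew lexle_refl implybT.
Qed.

(** Cutting at the degree of the left factor gives the leading words of both factors; at any other
    cut the left word has the wrong degree for [cf_support]. *)
Lemma cf_lead r (t : monomial m) : normal r t -> cf (mon_eval op x t) (lead t) = 1.
Proof.
elim: t r => [|i s IHs t IHt] r nt.
  by rewrite cf_x ?eqxx //; apply: (lead_mperm m0 (MGen m)).
case/and3P: (nt) => ri ns nt1.
set p := mon_degree s.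
have wP := lead_mperm m0 (MOp i s t).
have [v vE wE] := lead_MOp s (lead_op_ends m0 nt).
have sle : all (geq p) (lead s).
  by apply: sub_all (lead_letters m0 s) => y /andP[].
have tpos : all (ltn 0) (lead t).
  by apply: sub_all (lead_letters m0 t) => y /andP[].
have vpos : all (ltn 0) v /\ all (ltn 0) (nseq i (mon_degree t)).
  by apply/andP; rewrite -all_cat -vE.
have nE : nseq i (p + mon_degree t)%N = map (addn p) (nseq i (mon_degree t)).
  by rewrite map_nseq.
have loE : lo p (lead (MOp i s t)) = lead s.
  rewrite wE !lo_cat nE !lo_addn ?(vpos.1, vpos.2) // cats0.
  exact: (all_filterP sle).
have hiE : hi p (lead (MOp i s t)) = lead t.
  by rewrite wE !hi_cat nE !hi_addn ?(vpos.1, vpos.2) // hi_lo // vE.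
rewrite [mon_eval _ _ _]/= (cm_op model) // (deg_lead m0) /=.
rewrite big_mkcond (bigD1_seq p) ?iota_uniq //=; last first.
  by rewrite mem_index_iota -/p mon_degree_gt0 -addn1 leq_add2l mon_degree_gt0.
rewrite loE hiE (IHs _ ns) (IHt _ nt1) mulr1.
have -> : idx m p (lead (MOp i s t)) = i.
  rewrite /idx (lead_nmin m0 nt); first by apply/minn_idPr; rewrite -ltnS.
  by rewrite leqnn -[X in (X < _)%N]addn0 ltn_add2l mon_degree_gt0.
rewrite eqxx big_seq_cond big1 ?addr0 // => q.
rewrite mem_index_iota => /andP[/andP[q1 qK] qp]; case: ifP => // _.
suff /eqP-> : cf (mon_eval op x s) (lo q (lead (MOp i s t))) == 0 by rewrite mul0r.
apply/negPn/negP => /(cf_support ns)[_ dq _ _]; case/eqP: qp.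
rewrite /p -dq; have [] := @lo_mperm m q (lead (MOp i s t)) m0 wP; last by [].
by rewrite q1 (deg_lead m0) ltnW.
Qed.

(** Triangularity: among the monomials with nonzero coefficient, take one whose leading word is
    largest and read the coefficient of that word. *)
Lemma normal_free (L : seq (monomial m)) (c : monomial m -> K) :
  uniq L -> all (normal 0) L ->
  \sum_(t <- L) c t *: mon_eval op x t = 0 -> forall t, t \in L -> c t = 0.
Proof.
move=> uL nL S0 t tL; apply/eqP/negPn/negP => ct.
have {tL ct t} [t [tL ct tmax]] : exists t, [/\ t \in L, c t != 0 &
    forall t', t' \in L -> c t' != 0 -> lexle (lead t') (lead t)].
  elim: {uL nL S0} L t tL ct => // a L IH t; rewrite in_cons.
  case: (boolP (has (fun t => c t != 0) L)) => [/hasP[t1 t1L ct1] _ _|/hasPn N].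
    have [t2 [t2L ct2 max2]] := IH _ t1L ct1.
    case: (boolP ((c a != 0) && ~~ lexle (lead a) (lead t2))) => [/andP[ca la]|H].
      have la2 : lexle (lead t2) (lead a).
        by have := lexle_total (lead t2) (lead a); rewrite (negbTE la) orbF.
      exists a; split; rewrite ?mem_head // => t'; rewrite in_cons => /orP[/eqP->|t'L] ct'.
        exact: lexle_refl.
      exact: lexle_trans (max2 _ t'L ct') la2.
    exists t2; split; rewrite ?in_cons ?t2L ?orbT // => t'; rewrite in_cons.
    case/orP=> [/eqP->|t'L] ct'; last exact: max2.
    by move: H; rewrite ct' negbK.
  case/orP => [/eqP ->|/N /negP //] ca; exists a; split; rewrite ?mem_head // => t'.
  by rewrite in_cons => /orP[/eqP->|/N /negP //] _; apply: lexle_refl.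
have nt := allP nL _ tL.
have := congr1 (cf^~ (lead t)) S0; rewrite (cf_sum model) (cf0 model).
rewrite (bigD1_seq t) //= (cfZ model) (cf_lead nt) mulr1 big_seq_cond big1 ?addr0.
  by move=> E; rewrite E eqxx in ct.
move=> t' /andP[t'L tt']; rewrite (cfZ model).
case: (eqVneq (c t') 0) => [->|ct']; first by rewrite mul0r.
case: (eqVneq (cf (mon_eval op x t') (lead t)) 0) => [->|]; first by rewrite mulr0.
(* Another monomial with this word in its support would have a leading word at least as large, hence
   equal, against [lead_inj]. *)
move=> /(cf_support (allP nL _ t'L))[_ _ _ le1]; case/eqP: tt'.
apply: (lead_inj m0 (allP nL _ t'L) nt); apply: lexle_anti.
by rewrite le1 tmax.
Qed.

End Independence.

(** * Normal monomials span *)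

Section Spanning.
Variables (K : fieldType) (m : nat).
Hypothesis m0 : (0 < m)%N.
Notation family := (forall A : lmodType K, ('I_m.+1 -> A -> A -> A) -> A -> A).

Definition comb (A : lmodType K) (op : 'I_m.+1 -> A -> A -> A) (x : A)
    (p : seq (K * monomial m)) : A :=
  \sum_(y <- p) y.1 *: mon_eval op x y.2.

(** The list [p] is chosen before the algebra: one expansion must hold in all of them. *)
Definition nspan (P : pred (monomial m)) (F : family) : Prop :=
  exists2 p : seq (K * monomial m), all (fun y => P y.2) p &
    forall (A : lmodType K) (op : 'I_m.+1 -> A -> A -> A) (x : A),
      unified_dendriform op -> F A op x = comb op x p.

Lemma nspan_eq P (F G : family) :
  (forall (A : lmodType K) (op : 'I_m.+1 -> A -> A -> A) (x : A),
     unified_dendriform op -> F A op x = G A op x) ->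
  nspan P G -> nspan P F.
Proof. by move=> FG [p pP pE]; exists p => // A op x H; rewrite FG // pE. Qed.

Lemma nspan_sub (P Q : pred (monomial m)) (F : family) :
  (forall t, P t -> Q t) -> nspan P F -> nspan Q F.
Proof. by move=> PQ [p pP pE]; exists p => //; apply: sub_all pP => y; apply: PQ. Qed.

Lemma nspan_mon (P : pred (monomial m)) t : P t -> nspan P (fun A op x => mon_eval op x t).
Proof.
move=> Pt; exists [:: (1, t)] => [|A op x _] /=; first by rewrite Pt.
by rewrite /comb big_seq1 scale1r.
Qed.

Lemma nspan0 P : nspan P (fun A op x => 0).
Proof. by exists [::] => // A op x _; rewrite /comb big_nil. Qed.

Lemma nspan_lin P a (F G : family) : nspan P F -> nspan P G ->
  nspan P (fun A op x => a *: F A op x + G A op x).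
Proof.
move=> [p pP pE] [q qP qE].
exists ([seq (a * y.1, y.2) | y <- p] ++ q) => [|A op x H].
  by rewrite all_cat all_map qP andbT.
rewrite pE // qE // /comb big_cat big_map scaler_sumr; congr (_ + _).
by apply: eq_bigr => y _; rewrite scalerA.
Qed.

Lemma nspan_sum P I (r : seq I) (Q : pred I) (F : I -> family) :
  (forall i, Q i -> nspan P (F i)) ->
  nspan P (fun A op x => \sum_(i <- r | Q i) F i A op x).
Proof.
move=> H; elim: r => [|i r IH].
  by apply: nspan_eq (nspan0 P) => A op x _; rewrite big_nil.
case: (boolP (Q i)) => Qi; last first.
  by apply: nspan_eq IH => A op x _; rewrite big_cons (negbTE Qi).
by apply: nspan_eq (nspan_lin 1 (H _ Qi) IH) => A op x _; rewrite big_cons Qi scale1r.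
Qed.

Lemma nspan_op P Q R i (F G : family) : nspan P F -> nspan Q G ->
  (forall s t, P s -> Q t -> nspan R (fun A op x => mon_eval op x (MOp i s t))) ->
  nspan R (fun A op x => op i (F A op x) (G A op x)).
Proof.
move=> [p pP pE] [q qP qE] H.
apply: (@nspan_eq _ _ (fun A op x => op i (comb op x p) (comb op x q))).
  by move=> A op x dA; rewrite pE // qE.
elim: p pP {pE} => [_|[a s] p IH /= /andP[Ps pP]].
  apply: nspan_eq (nspan0 R) => A op x dA.
  by rewrite /comb big_nil (lin0 (ud_linearl dA i _)).
apply: (nspan_eq _ (nspan_lin a
  (F := fun A op x => op i (mon_eval op x s) (comb op x q)) _ (IH pP))).
  by move=> A op x dA; rewrite {1}/comb big_cons (ud_linearl dA i _ a).
elim: q qP {qE IH} => [_|[b t] q IH /= /andP[Qt qP]].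
  apply: nspan_eq (nspan0 R) => A op x dA.
  by rewrite /comb big_nil (lin0 (ud_linearr dA i _)).
apply: (nspan_eq _ (nspan_lin b (H _ _ Ps Qt) (IH qP))).
by move=> A op x dA; rewrite {1}/comb big_cons (ud_linearr dA i _ b).
Qed.

Definition normal_deg (r d : nat) : pred (monomial m) :=
  fun t => normal r t && (mon_degree t == d).

(** Rewriting of s op_a (v op_b w), by induction on the right factor. For a < b it is normal.
    Otherwise the relations give terms (s op_c v) op_b w, to which the hypotheses for [v] and then
    [w] apply, and, if a = b < m, also terms s op_a (v op_j w) with j > a. *)
Lemma nspan_MOp (a : 'I_m.+1) r s t : (r <= a)%N -> normal r t -> normal 0 s ->
  nspan (normal_deg r (mon_degree s + mon_degree t))
        (fun A op x => mon_eval op x (MOp a s t)).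
Proof.
elim: t a r s => [|b v IHv w IHw] a r s ra nt ns.
  by apply: nspan_mon; rewrite /normal_deg normal_MOp ra ns eqxx.
have := nt; rewrite normal_MOp => /and3P[rb nv nw].
have IHv' c : nspan (normal_deg 0 (mon_degree s + mon_degree v))
    (fun A op x => mon_eval op x (MOp c s v)).
  by apply: IHv => //; apply: normal_leq nv.
set d := (mon_degree s + _)%N.
(* The left factors in [F] are already normal, so the hypothesis on [w] with root label [b]
   applies. *)
have wspan (F : family) : nspan (normal_deg 0 (mon_degree s + mon_degree v)) F ->
    nspan (normal_deg r d) (fun A op x => op b (F A op x) (mon_eval op x w)).
  move=> nF; apply: (nspan_op nF (nspan_mon (P := pred1 w) (eqxx w))) => u w'.
  move=> /andP[nu /eqP du] /eqP ->; have nw' : normal b w by apply: normal_leq nw.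
  apply: nspan_sub (IHw b b u (leqnn b) nw' nu) => t.
  by rewrite /normal_deg du /d /= addnA => /andP[/(normal_leq rb) -> ->].
case: (ltngtP a b) => [ab|ba|/val_inj abE].
- by apply: nspan_mon; rewrite /normal_deg !normal_MOp ra ns ab nv nw eqxx.
- case: (ltnP a m) => am.
    (* The relation [ud_mid] with k = a - b, read from right to left. *)
    have km : (a - b < m.+1)%N by rewrite ltnS (leq_trans (leq_subr _ _)) // ltnW.
    apply: nspan_eq (wspan _ (IHv' (Ordinal km))) => A op x dA /=.
    by rewrite (ud_mid dA (l := a)) //= ?subn_gt0 // subnK // ltnW.
  have aE : a = ord_max by apply/val_inj/eqP; rewrite eqn_leq am -ltnS ltn_ord.
  apply: nspan_eq (wspan _ (nspan_sum (index_enum 'I_m.+1)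
    (Q := fun j : 'I_m.+1 => (m - b <= j)%N) (fun j _ => IHv' j))) => A op x dA.
  by rewrite [RHS](ud_succ dA) aE.
case: (ltnP a m) => am; last first.
  have aE : a = ord_max by apply/val_inj/eqP; rewrite eqn_leq am -ltnS ltn_ord.
  apply: nspan_eq (wspan _ (nspan_sum (index_enum 'I_m.+1)
    (Q := fun j : 'I_m.+1 => (m - b <= j)%N) (fun j _ => IHv' j))) => A op x dA.
  by rewrite [RHS](ud_succ dA) aE.
have nsum : nspan (normal_deg r d) (fun A op x =>
    op a (mon_eval op x s) (\sum_(j < m.+1 | (a < j)%N) op j (mon_eval op x v) (mon_eval op x w))).
  have nsum : nspan (normal_deg a.+1 (mon_degree v + mon_degree w)) (fun A op x =>
    \sum_(j < m.+1 | (a < j)%N) op j (mon_eval op x v) (mon_eval op x w)).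
    by apply: nspan_sum => j aj; apply: (IHw j a.+1 v aj); rewrite ?abE.
  apply: (nspan_op (nspan_mon (P := pred1 s) (eqxx s)) nsum) => s' t' /eqP -> /andP[nt' /eqP dt'].
  by apply: nspan_mon; rewrite /normal_deg normal_MOp ra ns nt' /= dt' eqxx.
(* The relation [ud_prec] at i = a, solved for the term j = a of its sum. *)
apply: nspan_eq (nspan_lin (-1) nsum (wspan _ (IHv' ord0))) => A op x dA /=.
rewrite -abE (ud_prec dA) // scaleN1r addrC.
rewrite (bigD1 a) //= (linD (ud_linearr dA a _)).
rewrite [X in op _ _ (op _ _ _) + op _ _ X](_ : _ = \sum_(j < m.+1 | (a < j)%N)
   op j (mon_eval op x v) (mon_eval op x w)) ?addrK //.
by apply: eq_bigl => j; rewrite ltn_neqAle andbC eq_sym.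
Qed.

Lemma nspan_monomial (t : monomial m) :
  nspan (normal_deg 0 (mon_degree t)) (fun A op x => mon_eval op x t).
Proof.
elim: t => [|i s IHs t IHt]; first exact: nspan_mon.
rewrite [mon_degree _]/=; apply: (nspan_op IHs IHt) => s' t' /andP[ns /eqP <-] /andP[nt /eqP <-].
by apply: nspan_MOp.
Qed.

End Spanning.

(** * Freeness *)

Lemma unified_transfer (K : fieldType) (m : nat) (V W : lmodType K)
    (opV : 'I_m.+1 -> V -> V -> V) (opW : 'I_m.+1 -> W -> W -> W) (f : V -> W) :
  linear f -> injective f -> is_dend_morphism opV opW f ->
  unified_dendriform opW -> unified_dendriform opV.
Proof.
move=> fL fI fM H; have lr := ud_linearr H; have ll := ud_linearl H.
split.
- by move=> i u a v w; apply: fI; rewrite fM !fL !fM lr.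
- by move=> i v a u w; apply: fI; rewrite fM !fL !fM ll.
- move=> i im u v w; apply: fI; rewrite !fM (ud_prec H) // (lin_sum fL).
  by congr (opW _ _ _); apply: eq_bigr => j _; rewrite fM.
- move=> i u v w; apply: fI; rewrite !fM -(ud_succ H) // (lin_sum fL).
  by congr (opW _ _ _); apply: eq_bigr => j _; rewrite fM.
- by move=> i k l k0 lE lm u v w; apply: fI; rewrite !fM (ud_mid H (l := l)).
Qed.

Lemma morph_mon_eval (K : fieldType) (m : nat) (V W : lmodType K)
    (opV : 'I_m.+1 -> V -> V -> V) (opW : 'I_m.+1 -> W -> W -> W) (f : V -> W) x :
  is_dend_morphism opV opW f ->
  forall t, f (mon_eval opV x t) = mon_eval opW (f x) t.
Proof. by move=> fM; elim=> //= i s <- t <-; rewrite fM. Qed.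

Section Comb.
Variables (K : fieldType) (m : nat).

Definition coefs (p : seq (K * monomial m)) (t : monomial m) : K :=
  \sum_(y <- p | y.2 == t) y.1.

Lemma comb_coefs (V : lmodType K) (op : 'I_m.+1 -> V -> V -> V) x p L :
  uniq L -> all (fun y => y.2 \in L) p ->
  comb op x p = \sum_(t <- L) coefs p t *: mon_eval op x t.
Proof.
move=> uL; elim: p => [|[a t] p IH] /=.
  by rewrite /comb big_nil big1 // => t _; rewrite /coefs big_nil scale0r.
move=> /andP[tL /IH E]; rewrite /comb big_cons -/(comb op x p) E /=.
rewrite !(bigD1_seq t) //= addrA /coefs big_cons eqxx scalerDl; congr (_ + _).
apply: eq_bigr => s st; congr (_ *: _).
by rewrite big_cons /= eq_sym (negbTE st).
Qed.

Lemma comb_cat (V : lmodType K) (op : 'I_m.+1 -> V -> V -> V) x p q :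
  comb op x (p ++ q) = comb op x p + comb op x q.
Proof. exact: big_cat. Qed.

Lemma comb_scale (V : lmodType K) (op : 'I_m.+1 -> V -> V -> V) x p a :
  comb op x [seq (a * y.1, y.2) | y <- p] = a *: comb op x p.
Proof.
by rewrite /comb big_map scaler_sumr; apply: eq_bigr => y _; rewrite scalerA.
Qed.

Lemma morph_comb (V W : lmodType K)
    (opV : 'I_m.+1 -> V -> V -> V) (opW : 'I_m.+1 -> W -> W -> W) (f : V -> W) x p :
  linear f -> is_dend_morphism opV opW f -> f (comb opV x p) = comb opW (f x) p.
Proof.
move=> fL fM; rewrite (lin_sum fL); apply: eq_bigr => y _.
by rewrite (linZ fL) (morph_mon_eval _ fM).
Qed.

End Comb.

Section Free.
Variables (K : fieldType) (m : nat) (M : lmodType K).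
Variables (opM : 'I_m.+1 -> M -> M -> M) (xM : M).
Notation normal_comb := (all (fun y : K * monomial m => normal 0 y.2)).
Hypothesis M_unified : unified_dendriform opM.
Hypothesis M_free : forall (L : seq (monomial m)) (c : monomial m -> K),
  uniq L -> all (normal 0) L ->
  \sum_(t <- L) c t *: mon_eval opM xM t = 0 -> forall t, t \in L -> c t = 0.

(** Independence in [M] makes every collected coefficient zero, and these coefficients do not
    involve the algebra. *)
Lemma comb_eq0 p : normal_comb p -> comb opM xM p = 0 ->
  forall (A : lmodType K) (op : 'I_m.+1 -> A -> A -> A) (x : A), comb op x p = 0.
Proof.
move=> nP; pose L := undup [seq y.2 | y <- p].
have uL : uniq L := undup_uniq _.
have pL : all (fun y => y.2 \in L) p.
  by apply/allP => y yp; rewrite mem_undup map_f.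
have nL : all (normal 0) L.
  apply/allP => t; rewrite mem_undup => /mapP[y yp ->]; exact: (allP nP).
rewrite (comb_coefs _ _ uL pL) => /(M_free uL nL) c0 A op x.
by rewrite (comb_coefs _ _ uL pL) big_seq big1 // => t /c0 ->; rewrite scale0r.
Qed.

Lemma comb_eq p q : normal_comb p -> normal_comb q -> comb opM xM p = comb opM xM q ->
  forall (A : lmodType K) (op : 'I_m.+1 -> A -> A -> A) (x : A),
  comb op x p = comb op x q.
Proof.
move=> nP nQ E A op x; apply/eqP; rewrite -subr_eq0; apply/eqP.
rewrite -scaleN1r -comb_scale -comb_cat; apply: comb_eq0.
  by rewrite all_cat nP all_map.
by rewrite comb_cat comb_scale E scaleN1r subrr.
Qed.

(** One list [r] serves the subalgebra and the target alike; [subalg_lift_morph] rests on this. *)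
Lemma comb_op i p q : normal_comb p -> normal_comb q ->
  exists2 r, normal_comb r &
    forall (A : lmodType K) (op : 'I_m.+1 -> A -> A -> A) (x : A),
    unified_dendriform op -> comb op x r = op i (comb op x p) (comb op x q).
Proof.
move=> nP nQ.
have nspan_comb r : normal_comb r -> nspan (normal 0) (fun A op x => @comb K m A op x r).
  by move=> nr; exists r.
have [s t ns nt|r nr rE] := nspan_op (R := normal 0) (i := i) (nspan_comb _ nP) (nspan_comb _ nQ).
  by apply: nspan_sub (nspan_MOp K (leq0n i) nt ns) => u /andP[].
by exists r => // A op x H; rewrite rE.
Qed.

Lemma generated_comb v : generated opM xM v ->
  exists2 p, normal_comb p & v = comb opM xM p.
Proof.
elim=> [|i u w _ [p np ->] _ [q nq ->]| |a u w _ [p np ->] _ [q nq ->]].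
- by exists [:: (1, MGen m)]; rewrite // /comb big_seq1 scale1r.
- by have [r nr rE] := comb_op i np nq; exists r; rewrite ?rE //; apply: M_unified.
- by exists [::]; rewrite // /comb big_nil.
exists ([seq (a * y.1, y.2) | y <- p] ++ q); first by rewrite all_cat all_map np.
by rewrite comb_cat comb_scale.
Qed.

Notation D := (subalg opM xM).
Notation opD := (@subalg_op K m M opM xM).
Notation xD := (subalg_gen opM xM).
Notation dval := (@subalg_val K m M opM xM).

Lemma dval_linear : linear (dval : D -> M).
Proof. by []. Qed.

Lemma dval_morph : is_dend_morphism opD opM (dval : D -> M).
Proof. by []. Qed.

Lemma dval_inj : injective dval.
Proof. exact: val_inj. Qed.

Lemma subalg_independent (L : seq (monomial m)) (c : monomial m -> K) :
  uniq L -> all (normal 0) L ->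
  \sum_(t <- L) c t *: mon_eval opD xD t = 0 -> forall t, t \in L -> c t = 0.
Proof.
move=> uL nL S0; apply: M_free => //.
have := congr1 dval S0; rewrite (lin_sum dval_linear) => E; rewrite -[RHS]E.
apply: eq_bigr => t _; rewrite (linZ dval_linear); congr (_ *: _).
by rewrite (morph_mon_eval _ dval_morph).
Qed.

Lemma subalg_unified : unified_dendriform opD.
Proof. exact: unified_transfer dval_linear dval_inj dval_morph M_unified. Qed.

Lemma subalg_comb (v : D) : exists p, normal_comb p && (v == comb opD xD p).
Proof.
have /subalg_predP/generated_comb[p np vE] := subalg_valP v.
exists p; rewrite np; apply/eqP/dval_inj.
by rewrite vE (morph_comb _ _ dval_linear dval_morph).
Qed.

Definition subalg_expansion (v : D) : seq (K * monomial m) := sval (cid (subalg_comb v)).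

Lemma subalg_expansion_normal v : normal_comb (subalg_expansion v).
Proof. by rewrite /subalg_expansion; case: cid => p /= /andP[]. Qed.

Lemma subalg_expansionK v : v = comb opD xD (subalg_expansion v).
Proof. by rewrite /subalg_expansion; case: cid => p /= /andP[_ /eqP]. Qed.

Section Lift.
Variables (A : lmodType K) (opA : 'I_m.+1 -> A -> A -> A) (a : A).
Hypothesis HA : unified_dendriform opA.

Definition subalg_lift (v : D) : A := comb opA a (subalg_expansion v).

(** By [comb_eq] the value does not depend on the expansion chosen; linearity and compatibility with
    the operations follow by picking convenient expansions. *)
Lemma subalg_liftE v p : normal_comb p -> v = comb opD xD p -> subalg_lift v = comb opA a p.
Proof.
move=> np vE; apply: comb_eq => //; first exact: subalg_expansion_normal.
rewrite -!(morph_comb xD _ dval_linear dval_morph : _ = comb opM xM _).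
by rewrite -subalg_expansionK vE.
Qed.

Lemma subalg_lift_linear : linear subalg_lift.
Proof.
move=> b u v; rewrite (@subalg_liftE _
  ([seq (b * y.1, y.2) | y <- subalg_expansion u] ++ subalg_expansion v)).
- by rewrite comb_cat comb_scale.
- by rewrite all_cat all_map !subalg_expansion_normal.
by rewrite comb_cat comb_scale -!subalg_expansionK.
Qed.

HB.instance Definition _ := GRing.isLinear.Build K D A *:%R subalg_lift subalg_lift_linear.

Lemma subalg_lift_morph : is_dend_morphism opD opA subalg_lift.
Proof.
move=> i u v.
have [r nr rE] := comb_op i (subalg_expansion_normal u) (subalg_expansion_normal v).
by rewrite (subalg_liftE nr) ?rE -?subalg_expansionK //; apply: subalg_unified.
Qed.

Lemma subalg_lift_gen : subalg_lift xD = a.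
Proof.
by rewrite (@subalg_liftE _ [:: (1, MGen m)]) // /comb big_seq1 scale1r.
Qed.

Lemma subalg_lift_unique (g : {linear D -> A}) :
  is_dend_morphism opD opA g -> g xD = a -> g =1 subalg_lift.
Proof.
move=> gM ga v; rewrite {1}(subalg_expansionK v).
by rewrite (morph_comb _ _ (linearP g) gM) ga.
Qed.

Lemma subalg_lift_spec : exists f : {linear D -> A},
  [/\ is_dend_morphism opD opA f, f xD = a &
      forall g : {linear D -> A},
        is_dend_morphism opD opA g -> g xD = a -> g =1 f].
Proof.
exists subalg_lift; split.
- exact: subalg_lift_morph.
- exact: subalg_lift_gen.
exact: subalg_lift_unique.
Qed.

End Lift.

Lemma subalg_free : (0 < m)%N -> is_free_dendriform opD xD.
Proof.
move=> m0; split; first exact/(dendriform_unified _ m0)/subalg_unified.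
by move=> A opA /(dendriform_unified _ m0) HA a; apply: subalg_lift_spec.
Qed.

End Free.

(** The lifts of the two generators are mutually inverse, since both composites are endomorphisms
    fixing a generator. *)
Lemma free_isomorphic (K : fieldType) (m : nat) (V W : lmodType K)
    (opV : 'I_m.+1 -> V -> V -> V) (opW : 'I_m.+1 -> W -> W -> W) x y :
  is_free_dendriform opV x -> is_free_dendriform opW y -> dend_isomorphic opV opW.
Proof.
move=> [HV freeV] [HW freeW].
have [f [fM fx _]] := freeV _ _ HW y; have [g [gM gy _]] := freeW _ _ HV x.
have id_unique (U : lmodType K) (opU : 'I_m.+1 -> U -> U -> U) z (h : {linear U -> U}) :
    is_free_dendriform opU z -> is_dend_morphism opU opU h -> h z = z -> h =1 id.
  move=> [HU /(_ _ _ HU z)[k [_ _ kU]]] hM hz v.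
  by rewrite (kU h hM hz) -(kU (idfun : {linear U -> U})).
exists f => //; exists g => v.
  apply: (id_unique _ opV x (g \o f : {linear V -> V})) => //=; last by rewrite fx.
  by move=> i u w /=; rewrite fM gM.
apply: (id_unique _ opW y (f \o g : {linear W -> W})) => //=; last by rewrite gy.
by move=> i u w /=; rewrite gM fM.
Qed.

Section MFQSym.
Variables (K : fieldType) (m : nat).
Hypothesis m0 : (0 < m)%N.

Lemma mFQSym_unified : unified_dendriform (@mFQSym_op K m).
Proof. exact: model_unified m0 (mFQSym_model K m0). Qed.

Lemma mFQSym_free (L : seq (monomial m)) (c : monomial m -> K) :
  uniq L -> all (normal 0) L ->
  \sum_(t <- L) c t *: mon_eval (@mFQSym_op K m) (mF K m (nseq m 1%N)) t = 0 ->
  forall t, t \in L -> c t = 0.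
Proof.
apply: (normal_free m0 (mFQSym_model K m0)) => w wP.
exact: (wcoef_mF K wP (ones_mperm m0)).
Qed.

Lemma Dp_free : is_free_dendriform (@Dp_op K m) (Dp_gen K m).
Proof. exact: subalg_free mFQSym_unified mFQSym_free m0. Qed.

Lemma Dp_independent (L : seq (monomial m)) (c : monomial m -> K) :
  uniq L -> all (normal 0) L ->
  \sum_(t <- L) c t *: mon_eval (@Dp_op K m) (Dp_gen K m) t = 0 ->
  forall t, t \in L -> c t = 0.
Proof. exact: subalg_independent mFQSym_free _ _. Qed.

End MFQSym.

(** * Dimensions of the homogeneous components *)

Section Dimension.
Variables (K : fieldType) (m : nat) (V : lmodType K).
Variables (op : 'I_m.+1 -> V -> V -> V) (x : V).
Hypothesis m0 : (0 < m)%N.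
Hypothesis freeV : is_free_dendriform op x.

Notation basis n := (normals m n m.+1 n).

Lemma mem_basis n t : (t \in basis n) = normal_deg 0 n t.
Proof. by rewrite mem_normals // subnn. Qed.

Lemma size_basis n : (0 < n)%N -> size (basis n) = fuss_catalan m n.
Proof. by case: n => // n _; rewrite size_normals // -raney_fuss_catalan. Qed.

Lemma homogeneous_basis n t : t \in basis n -> homogeneous op x n (mon_eval op x t).
Proof.
rewrite mem_basis => /andP[_ /eqP dt].
exists 1%N, (fun=> 1), (fun=> mon_eval op x t); split=> [_|]; first by exists t.
by rewrite big_ord1 scale1r.
Qed.

(** The morphism sending [x] to the generator of [Dp] carries a relation to [Dp], where normal
    monomials are independent. *)
Lemma basis_free n (c : monomial m -> K) :
  \sum_(t <- basis n) c t *: mon_eval op x t = 0 -> forall t, t \in basis n -> c t = 0.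
Proof.
have [H /(_ _ _ (Dp_free K m0).1 (Dp_gen K m))[f [fM fx _]]] := freeV.
move=> S0; apply: (Dp_independent (K := K) m0); first exact: uniq_normals.
  by apply/allP => t; rewrite mem_basis => /andP[].
have := congr1 f S0; rewrite linear0 linear_sum => E; rewrite -[RHS]E.
by apply: eq_bigr => t _; rewrite linearZ (morph_mon_eval _ fM) fx.
Qed.

(** The expansion in [nspan_monomial] preserves the degree. *)
Lemma homogeneous_span n v : homogeneous op x n v ->
  exists c : monomial m -> K, v = \sum_(t <- basis n) c t *: mon_eval op x t.
Proof.
move=> [k [c [w [wP ->]]]]; have /(dendriform_unified _ m0) H := freeV.1.
have [p pn pE] : exists2 p, all (fun y : K * monomial m => y.2 \in basis n) p &
    \sum_i c i *: w i = comb op x p.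
  elim: (index_enum _) => [|i r [p pn pE]]; first by exists [::]; rewrite // /comb !big_nil.
  have [t dt wt] := wP i; have [q qn qE] := nspan_monomial K t.
  exists ([seq (c i * y.1, y.2) | y <- q] ++ p).
    rewrite all_cat pn all_map andbT; apply: sub_all qn => y /=.
    by rewrite mem_basis dt.
  by rewrite big_cons pE comb_cat comb_scale wt qE.
by exists (coefs p); rewrite pE; apply: comb_coefs => //; apply: uniq_normals.
Qed.

Lemma homogeneous_dim n : (0 < n)%N -> has_dim (homogeneous op x n) (fuss_catalan m n).
Proof.
move=> n0; rewrite -size_basis //; set L := basis n.
exists (fun i => mon_eval op x (nth (MGen m) L i)); split=> [i|c S0 i|v].
- by apply/homogeneous_basis/mem_nth.
(* This moves the coefficients from positions to monomials; [L] has no repetition, so [index]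
   recovers the position, and the default 0 is taken only off [L]. *)
- pose d t := if insub (index t L) is Some j then c j else 0.
  have uL : uniq L by apply: uniq_normals.
  have dE (j : 'I_(size L)) : d (nth (MGen m) L j) = c j.
    by rewrite /d index_uniq // valK.
  rewrite -dE; apply: (@basis_free n); last exact: mem_nth.
  rewrite -[RHS]S0 (big_nth (MGen m)) big_mkord.
  by apply: eq_bigr => j _; rewrite dE.
move=> /homogeneous_span[c ->]; exists (fun i => c (nth (MGen m) L i)).
by rewrite (big_nth (MGen m)) big_mkord.
Qed.

End Dimension.

Theorem theorem4p5 (K : fieldType) (char0 : [pchar K] =i pred0)
    (m : nat) (m_ge1 : (1 <= m)%N) :
  (forall (D : lmodType K) (opD : 'I_m.+1 -> D -> D -> D) (x : D),
     is_free_dendriform opD x ->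
     (forall n : nat, (1 <= n)%N ->
        has_dim (homogeneous opD x n) (fuss_catalan m n)) /\
     dend_isomorphic (@Dp_op K m) opD) /\
  is_free_dendriform (@Dp_op K m) (Dp_gen K m).
Proof.
have freeDp := Dp_free K m_ge1; split=> // D opD x freeD; split.
  by move=> n n0; apply: homogeneous_dim.
exact: free_isomorphic freeDp freeD.
Qed.
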